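(* Let $1\le p\le\infty$, $1<r<\infty$, $\kappa\in\mathbb{Z}$, let $\lambda:\mathbb{R}\to\mathbb{R}\setminus\{0\}$ be a bounded function which is a mask of type $(r,\kappa)$, and let $\beta:\mathbb{R}\to\mathbb{R}$ be a function of exponent type. Then there exists a positive constant $c$ such that for all $f\in\mathcal{H}_{\lambda,p}(\mathbb{T})$ and all $m\in\mathbb{N}$, $$\|f-Q_{m,\beta}(f)\|_p\le c\,m^{-r}(\log(m+1))^{-\kappa}\,\|f\|_{\mathcal{H}_{\lambda,p}(\mathbb{T})}.$$
   Context: $\mathbb{T}$ is the torus $[0,2\pi]$ with endpoints identified; $L^p(\mathbb{T})$ has norm $\|f\|_p=\big(\frac1{2\pi}\int_{\mathbb{T}}|f|^p\big)^{1/p}$ for $p<\infty$ and the essential supremum norm for $p=\infty$ (functions may be taken real or complex valued). Convolution is normalized, $(f_1*f_2)(x)=\frac{1}{2\pi}\int_{\mathbb{T}}f_1(x-t)f_2(t)\,dt$, so that Fourier coefficients $\widehat f(k)=\frac1{2\pi}\int_{\mathbb{T}}f(x)e^{-ikx}dx$ multiply. For a bounded function $\lambda:\mathbb{R}\to\mathbb{R}\setminus\{0\}$, $\varphi_\lambda(x):=\sum_{k\in\mathbb{Z}}\lambda(k)e^{ikx}$ (similarly $\varphi_\beta$), and $\mathcal{H}_{\lambda,p}(\mathbb{T}):=\{f=\varphi_\lambda*g:\ g\in L^p(\mathbb{T})\}$ with norm $\|f\|_{\mathcal{H}_{\lambda,p}(\mathbb{T})}:=\|g\|_p$. For $r,\kappa\in\mathbb{R}$,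 a function $f:\mathbb{R}\to\mathbb{R}$ is a mask of type $(r,\kappa)$ if $f$ is even, 2-times continuously differentiable, and for $t\ge1$, $f(t)=|t|^{-r}(\log(|t|+1))^{-\kappa}F(\log|t|)$ for some (twice differentiable) $F:\mathbb{R}\to\mathbb{R}$ such that, for a constant $a_1$, $|F^{(k)}(t)|\le a_1$ for all $t\ge1$, $k=0,1,2$. A function $f:\mathbb{R}\to\mathbb{R}$ is of exponent type if it is 2-times continuously differentiable and there is a constant $s>0$ such that $f(t)=e^{-s|t|}F(|t|)$ for some decreasing function $F:[0,+\infty)\to(0,+\infty)$. Fix a 2-times continuously differentiable $\vartheta:\mathbb{R}\to\mathbb{R}$ with $\vartheta(x)=1$ for $x\in[-\frac12,\frac12]$ and $\vartheta(x)=0$ for $x\notin(-1,1)$. Put $\mathcal{G}=\lambda/\beta$, $H_m(x):=\sum_{k\in\mathbb{Z}}\vartheta(k/m)\mathcal{G}(k)e^{ikx}$, and $V_m(g):=H_m*g$. For $f=\varphi_\lambda*g\in\mathcal{H}_{\lambda,p}(\mathbb{T})$, $$Q_{m,\beta}(f):=\frac1{2m+1}\sum_{k=0}^{2m}V_m(g)\Big(\frac{2\pi k}{2m+1}\Big)\,\varphi_\beta\Big(\cdot-\frac{2\pi k}{2m+1}\Big).$$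
   Formalization: As defined, no function of exponent type exists: being even and twice continuously differentiable forces derivative 0 at 0, but the right derivative there is at most -sF(0)<0; here twice continuous differentiability is required only away from 0. *)

(* Defs.v *)
From HB Require Import structures.
From mathcomp Require Import all_boot all_order all_algebra.
From mathcomp Require Import all_classical all_reals all_analysis.
From mathcomp Require Import complex lra.

Set Implicit Arguments.
Unset Strict Implicit.
Unset Printing Implicit Defensive.

Import Order.TTheory GRing.Theory Num.Theory.
Import numFieldNormedType.Exports.

Local Open Scope classical_set_scope.
Local Open Scope ring_scope.
Local Open Scope complex_scope.

(* Functions on the torus are 2pi-periodic functions R -> R[i]. The measure
   below is dt/(2pi) carried by [0, 2pi], so that integrals, convolutions and
   Lp-norms with respect to it have the normalization 1/(2pi) built in. *)
Lemma inv2pi_ge0 (R : realType) : 0 <= (2 * pi)^-1 :> R.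
Proof. by rewrite invr_ge0 mulr_ge0 // pi_ge0. Qed.

Definition torus_measure (R : realType) : {measure set (measurableTypeR R) -> \bar R} :=
  mscale (NngNum (inv2pi_ge0 R))
    (mrestr (@lebesgue_measure R) (measurable_itv `[0, 2 * pi]%R)).

Definition cexpi (R : realType) (t : R) : R[i] := cos t +i* sin t.

Definition climn (R : realType) (u : nat -> R[i]) : R[i] :=
  limn (fun n => complex.Re (u n)) +i* limn (fun n => complex.Im (u n)).

Definition cintegral (R : realType) (h : R -> R[i]) : R[i] :=
  Rintegral (@torus_measure R) setT (fun t => complex.Re (h t)) +i*
  Rintegral (@torus_measure R) setT (fun t => complex.Im (h t)).

Definition torus_conv (R : realType) (f1 f2 : R -> R[i]) (x : R) : R[i] :=
  cintegral (fun t => f1 (x - t) * f2 t).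

(* p : \bar R with 1 <= p; p = +oo is the essential supremum norm *)
Definition Lpnorm (R : realType) (p : \bar R) (f : R -> R[i]) : \bar R :=
  Lnorm (@torus_measure R) p (fun x => (ComplexField.Normc.normc (f x))%:E).

Definition Lp_torus (R : realType) (p : \bar R) (g : R -> R[i]) : Prop :=
  [/\ measurable_fun setT (fun x => complex.Re (g x)),
      measurable_fun setT (fun x => complex.Im (g x)),
      forall x, g (x + 2 * pi) = g x
    & (Lpnorm p g < +oo)%E].

(* sum over k in Z of a(k) e^(ikx), as the limit of the sums over |k| <= n
   (in the n-th sum the index j = i - n runs over -n, ..., n). It is used for
   absolutely summable (lambda with r > 1, beta) or finitely supported (H_m)
   coefficients only, so the order of summation does not matter. *)
Definition phi (R : realType) (a : R -> R) (x : R) : R[i] :=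
  climn (fun n => \sum_(i < (2 * n).+1)
    let j : R := i%:R - n%:R in (a j)%:C * cexpi (j * x)).

(* f = phi_lambda * g with g in L^p. When lambda has no zero, the Fourier
   coefficients of f determine those of g, so g is determined by f almost
   everywhere: ||f||_{H_{lambda,p}} is Lpnorm p g, and the value at f of an
   operator given by a formula in g is that formula. *)
Definition in_H (R : realType) (lambda : R -> R) (p : \bar R)
    (f g : R -> R[i]) : Prop :=
  Lp_torus p g /\ f = torus_conv (phi lambda) g.

Definition C2_at (R : realType) (f : R -> R) (x : R) : Prop :=
  [/\ derivable f x 1, derivable (derive1 f) x 1
    & {for x, continuous (derive1n 2 f)}].

Definition decay_mask (R : realType) (r kappa : R) (f : R -> R) : Prop :=
  [/\ forall t, f (- t) = f t,
      forall t, C2_at f t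
    & exists F : R -> R,
      [/\ forall t, derivable F t 1 /\ derivable (derive1 F) t 1,
          forall t, 1 <= t ->
            f t = `|t| `^ (- r) * ln (`|t| + 1) `^ (- kappa) * F (ln `|t|)
        & exists a1 : R, forall (k : nat) (t : R), (k <= 2)%N -> 1 <= t ->
            `|derive1n k F t| <= a1] ].

(* Twice continuous differentiability is required away from the origin only.
   A function e^(-s|t|) F(|t|) with F positive and decreasing has a corner at 0
   (lemma exponent_type_not_derivable0), so requiring it at 0 as well would
   leave no function at all, excluding even e^(-s|t|). *)
Definition exponent_type (R : realType) (f : R -> R) : Prop :=
  (forall t, t != 0 -> C2_at f t) /\
  exists s : R, 0 < s /\ exists F : R -> R,
    [/\ forall t, 0 <= t -> 0 < F t,
        forall t u, 0 <= t -> t <= u -> F u <= F t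
      & forall t, f t = expR (- s * `|t|) * F `|t|].

Definition cutoff (R : realType) (theta : R -> R) : Prop :=
  [/\ forall t, C2_at theta t,
      forall x, - 2^-1 <= x <= 2^-1 -> theta x = 1
    & forall x, ~~ (- 1 < x < 1) -> theta x = 0].

Definition Hm (R : realType) (theta lambda beta : R -> R) (m : nat) :
    R -> R[i] :=
  phi (fun t => theta (t / m%:R) * (lambda t / beta t)).

Definition Vm (R : realType) (theta lambda beta : R -> R) (m : nat)
    (g : R -> R[i]) : R -> R[i] :=
  torus_conv (Hm theta lambda beta m) g.

(* Q_{m,beta}(f) for f = phi_lambda * g *)
Definition Qm (R : realType) (theta lambda beta : R -> R) (m : nat)
    (g : R -> R[i]) (x : R) : R[i] :=
  ((2 * m).+1%:R^-1)%:C *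
  \sum_(k < (2 * m).+1)
    let xk : R := 2 * pi * k%:R / (2 * m).+1%:R in
    Vm theta lambda beta m g xk * phi beta (x - xk).

Lemma exponent_type_not_derivable0 (R : realType) (f : R -> R) :
  exponent_type f -> ~ derivable f 0 1.
Proof.
move=> [_ [s [s0 [F [F0 Fd fE]]]]] /cvg_ex[/= l /cvgrPdist_lt dl].
have F00 : 0 < F 0 by exact: F0.
have e0 : 0 < s * F 0 / 4 by rewrite divr_gt0 ?mulr_gt0.
have [d /= d0 {}dl] := dl _ e0.
pose h := Num.min (d / 2) s^-1.
have h0 : 0 < h by rewrite lt_min divr_gt0 //= invr_gt0.
have hd : h < d by rewrite gt_min ltr_pdivrMr // mulr2n mulrDr mulr1 ltrDl d0.
have sh1 : s * h <= 1 by rewrite mulrC -ler_pdivlMr // div1r ge_min lexx orbT.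
have fhE : f (- h) = f h by rewrite !fE normrN.
have fh : f h - f 0 <= - (s * F 0 / 2) * h.
  rewrite !fE normr0 mulr0 expR0 mul1r gtr0_norm // mulNr expRN.
  have sh0 : 0 < s * h by rewrite mulr_gt0.
  have Fh : F h <= F 0 by exact: Fd (ltW h0).
  have eb : (expR (s * h))^-1 <= (1 + s * h)^-1.
    by rewrite lef_pV2 ?posrE ?expR_gt0 ?addr_gt0 // expR_ge1Dx.
  have eb' : (1 + s * h)^-1 <= 1 - s * h / 2.
    by rewrite -[_^-1]mul1r ler_pdivrMr ?addr_gt0 //; nra.
  have E0 : 0 < (expR (s * h))^-1 by rewrite invr_gt0 expR_gt0.
  nra.
have dlh u : `|u| = h -> `|l - u^-1 * (f u - f 0)| < s * F 0 / 4.
  move=> uh; have := dl u; rewrite /= sub0r normrN uh addr0 /GRing.scale /= mulr1.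
  by apply => //; rewrite -normr_gt0 uh.
have := dlh h (gtr0_norm h0).
have := dlh (- h); rewrite normrN gtr0_norm // fhE invrN mulNr opprK => /(_ erefl).
have q : h^-1 * (f h - f 0) <= - (s * F 0 / 2).
  by rewrite mulrC ler_pdivrMr.
by rewrite !ltr_norml => /andP[+ _] /andP[_ +]; lra.
Qed.

(* Main.v *)
Require Import Defs.
From HB Require Import structures.
From mathcomp Require Import all_boot all_order all_algebra.
From mathcomp Require Import all_classical all_reals all_analysis.
From mathcomp Require Import measurable_realfun ess_sup_inf complex ring lra.

Set Implicit Arguments.
Unset Strict Implicit.
Unset Printing Implicit Defensive.

Import Order.TTheory GRing.Theory Num.Theory.
Import numFieldNormedType.Exports.

Local Open Scope classical_set_scope.
Local Open Scope ring_scope.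

(** The error f - Q f is an integral operator applied to g: by linearity of the
    integral, with dt normalized to mass 1,
      f(x) - Q f(x) = int D(x, t) g(t) dt,
      D(x, t) = phi_lambda(x - t)
                - 1/(2m+1) sum_k H_m(x_k - t) phi_beta(x - x_k),
    with x_k = 2 pi k / (2m+1) (error_integral). So the theorem is a statement
    about the size of the kernel D alone, and Schur's test (schur_test) turns
    the pointwise bound
      |D(x, t)| <= C w(m) (1 + m / (1 + m^2 |1 - exp(i(x - t))|^2)),
      w(t) = t^(-r) (ln (t + 1))^(-kappa),
    of error_kernel_bound into the estimate in every L^p at once: the right-hand
    side is symmetric in x and t, and its integral in either variable is at most
    7 C w(m), as one sees by comparing it with Lorentzians, whose primitives are
    arctangents (poisson_integral).

    The bound on D has two parts. Split phi_beta into its frequencies up to m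
    and the others. For the former, characters of frequency at most m are
    orthogonal on the 2m+1 nodes, so that the sampled sum is exactly the sum
    of theta(l/m) lambda(l) exp(il(x - t)), and subtracting it from phi_lambda
    leaves the kernel of symbol a(l) = (1 - theta(l/m)) lambda(l). This symbol
    lives on |l| >= m/2, where lambda and its first two derivatives have at
    most the sizes w(l), w(l)/|l| and w(l)/l^2. Hence the sum of the |a(l)| is
    of order at most m w(m), here r > 1 is used, and the sum of the second
    differences is of order at most w(m) / m. The first sum bounds the kernel;
    after two summations by parts the second one bounds |1 - exp(iu)|^2 times
    the kernel at u. Together these give the bound above (highpass_kernel).
    The logarithm and the comparison of w at different points are dealt with
    by a Potter bound (weight_potter).

    For the frequencies of phi_beta beyond m, the exponential decay of beta is
    so strong that absolute values suffice. Measured against beta(m), the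
    coefficients beta(l) with |l| > m are at most exp(-s(|l| - m)), and
    lambda(j) / beta(j) with |j| <= m is at most |lambda(j)| exp(-s(m - |j|));
    the exponential outweighs the growth of w below m, so that the two sums
    multiply to O(w(m)) (aliasing_bounds). *)

(** * Complex exponentials and symmetric sums *)

Notation normc := ComplexField.Normc.normc.

Lemma normc_ge0 (R : realType) (z : R[i]) : 0 <= normc z.
Proof. by case: z => a b; rewrite /= sqrtr_ge0. Qed.

Lemma normc_real (R : realType) (a : R) : normc (a%:C)%C = `|a|.
Proof. by rewrite /= expr0n addr0 sqrtr_sqr. Qed.

Lemma normc_sum (R : realType) (I : Type) (s : seq I) (P : pred I) (F : I ->
    R[i]) :
  normc (\sum_(i <- s | P i) F i) <= \sum_(i <- s | P i) normc (F i).
Proof.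
elim/big_rec2: _ => [|i y x _ h]; first by rewrite ComplexField.Normc.normc0.
by rewrite (le_trans (le_normcD _ _))// lerD2l.
Qed.

Lemma Re_le_normc (R : realType) (z : R[i]) : `|complex.Re z| <= normc z.
Proof.
by case: z => a b /=; rewrite -sqrtr_sqr ler_wsqrtr// lerDl sqr_ge0.
Qed.

Lemma Im_le_normc (R : realType) (z : R[i]) : `|complex.Im z| <= normc z.
Proof.
by case: z => a b /=; rewrite -sqrtr_sqr ler_wsqrtr// lerDr sqr_ge0.
Qed.

Lemma normc_le_ReIm (R : realType) (z : R[i]) :
  normc z <= `|complex.Re z| + `|complex.Im z|.
Proof.
case: z => a b /=; rewrite -[leRHS]ger0_norm ?addr_ge0// -sqrtr_sqr ler_wsqrtr//.
rewrite sqrrD !real_normK ?num_real// -addrA lerD2l lerDr.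
by rewrite mulrn_wge0// mulr_ge0.
Qed.

Lemma ReD (R : realType) (z c : R[i]) :
  complex.Re (z + c) = complex.Re z + complex.Re c.
Proof. by case: z c => [? ?] []. Qed.

Lemma ImD (R : realType) (z c : R[i]) :
  complex.Im (z + c) = complex.Im z + complex.Im c.
Proof. by case: z c => [? ?] []. Qed.

Section cexpi.
Context {R : realType}.
Implicit Types x y : R.

Lemma cexpi0 : cexpi 0 = 1 :> R[i].
Proof. by rewrite /cexpi cos0 sin0. Qed.

Lemma cexpiD x y : cexpi (x + y) = cexpi x * cexpi y.
Proof.
rewrite /cexpi cosD sinD.
by apply/eqP; rewrite eq_complex /=; apply/andP; split; apply/eqP; ring.
Qed.

Lemma cexpiX x (k : nat) : cexpi (x * k%:R) = cexpi x ^+ k.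
Proof.
elim: k => [|k IH]; first by rewrite mulr0 cexpi0 expr0.
by rewrite -addn1 natrD mulrDr mulr1 cexpiD IH exprD expr1.
Qed.

Lemma normc_cexpi x : normc (cexpi x) = 1.
Proof. by rewrite /cexpi /= cos2Dsin2 sqrtr1. Qed.

Lemma cexpi_pi2 (k : nat) : cexpi (2 * pi * k%:R) = 1 :> R[i].
Proof.
rewrite cexpiX (_ : 2 * pi = pi *+ 2); last by rewrite mulr_natl.
by rewrite /cexpi cos2pi sin2pi expr1n.
Qed.

(** Otherwise the sine of x / 2, an angle strictly between 0 and pi, would
    vanish. *)
Lemma cexpi_neq1 x : 0 < x < 2 * pi -> cexpi x != 1.
Proof.
move=> /andP[x0 x2]; apply/negP; rewrite eq_complex => /andP[/eqP/= + _].
have -> : x = (x / 2) *+ 2 by rewrite -mulr_natr divfK.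
rewrite cos_mulr2n => h.
have : sin (x / 2) = 0.
  apply/eqP; rewrite -sqrf_eq0 sin2cos2; apply/eqP.
  by move: h; rewrite -mulr_natl; lra.
have /lt0r_neq0/eqP : 0 < sin (x / 2) by apply: sin_gt0_pi; apply/andP; split;
    lra.
by [].
Qed.

End cexpi.

Section roots_of_unity.
Context {R : realType}.

Let root_sum (d N : nat) : (0 < d < N)%N ->
  \sum_(k < N) cexpi (d%:R * (2 * pi * k%:R / N%:R)) = 0 :> R[i].
Proof.
move=> /andP[d0 dN]; have N0 : (0 < N)%N by rewrite (leq_trans d0)// ltnW.
pose z : R[i] := cexpi (2 * pi * d%:R / N%:R).
have zE k : cexpi (d%:R * (2 * pi * k%:R / N%:R)) = z ^+ k.
  by rewrite -cexpiX; congr cexpi; ring.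
under eq_bigr do rewrite zE.
have z1 : z != 1.
  apply: cexpi_neq1; rewrite !mulr_gt0 ?invr_gt0 ?pi_gt0 ?ltr0n//=.
  by rewrite ltr_pdivrMr ?ltr0n// ltr_pM2l ?mulr_gt0 ?pi_gt0// ltr_nat.
have zN : z ^+ N = 1.
  rewrite -cexpiX divfK; last by rewrite pnatr_eq0 -lt0n.
  by rewrite cexpi_pi2.
have := subrX1 z N; rewrite zN subrr => /esym/eqP.
by rewrite mulf_eq0 subr_eq0 (negbTE z1) /= => /eqP.
Qed.

(** The indices i and j stand for the frequencies i - m and j - m of [-m, m].
    A nonzero difference of two of them is no multiple of 2m+1, so that the sum
    runs over all powers of a root of unity other than 1. *)
Lemma sampled_orthogonality (m i j : nat) : (i < (2 * m).+1)%N ->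
  (j < (2 * m).+1)%N ->
  \sum_(k < (2 * m).+1)
     cexpi ((i%:R - j%:R) * (2 * pi * k%:R / (2 * m).+1%:R)) =
  if i == j then (2 * m).+1%:R else 0 :> R[i].
Proof.
move=> im jm; have [->|ij] := eqVneq i j.
  under eq_bigr do rewrite subrr mul0r cexpi0.
  by rewrite sumr_const card_ord.
wlog ji : i j im jm ij / (j < i)%N => [hw|].
  have [|ij'|/eqP] := ltngtP j i; last by rewrite eq_sym (negbTE ij).
  - exact: hw.
  have h : \sum_(k < (2 * m).+1)
     cexpi ((j%:R - i%:R) * (2 * pi * k%:R / (2 * m).+1%:R)) = 0 :> R[i].
    by apply: hw => //; rewrite eq_sym.
  transitivity (conjc (\sum_(k < (2 * m).+1)
     cexpi ((j%:R - i%:R) * (2 * pi * k%:R / (2 * m).+1%:R)) : R[i])).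
    rewrite rmorph_sum/=; apply: eq_bigr => k _.
    by rewrite /cexpi /= -sinN -cosN; congr (cos _ +i* sin _)%C; ring.
  by rewrite h rmorph0.
under eq_bigr do rewrite -natrB ?(ltnW ji)//.
by apply: root_sum; rewrite subn_gt0 ji/= (leq_ltn_trans (leq_subr _ _)).
Qed.

End roots_of_unity.

Section symmetric_sums.

(** Sums over an interval [-n, n] of integers are written as in phi, with the
    index shifted by n; this splits them into pairs of opposite indices. *)
Lemma sum_symm (R : realType) (V : zmodType) (f : R -> V) (n : nat) :
  \sum_(i < (2 * n).+1) f (i%:R - n%:R) =
  f 0 + \sum_(k < n) (f k.+1%:R + f (- k.+1%:R)).
Proof.
rewrite -(big_mkord xpredT (fun i => f (i%:R - n%:R))).
rewrite (big_cat_nat (n := n)) //=; last by rewrite mul2n -addnn leqW// leq_addr.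
rewrite big_nat_recl; last by rewrite mul2n -addnn leq_addr.
rewrite subrr addrCA; congr (_ + _).
rewrite big_split/= addrC; congr (_ + _).
  rewrite -{1}(add0n n) big_addn mul2n -addnn addnK big_mkord.
  by apply: eq_bigr => i _; rewrite -addSn natrD addrK.
rewrite big_nat_rev/= big_mkord; apply: eq_bigr => i _.
by rewrite add0n natrB ?ltn_ord// -opprB; congr (f (- _)); ring.
Qed.

Lemma ler_sum_symm (R : realType) (f : R -> R) (b : nat -> R) (n : nat) :
  (forall k : nat, (k <= n)%N -> f k%:R <= b k) ->
  (forall k : nat, (k <= n)%N -> f (- k%:R) <= b k) ->
  (forall k, 0 <= b k) ->
  \sum_(i < (2 * n).+1) f (i%:R - n%:R) <= 2 * \sum_(k < n.+1) b k.
Proof.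
move=> f1 f2 b0; rewrite sum_symm big_ord_recl/= mulrDr lerD//.
  by rewrite (le_trans (f1 0%N isT))// ler_peMl ?ler1n.
rewrite mulr_sumr; apply: ler_sum => k _.
by rewrite mulr_natl mulr2n lerD// ?f1 ?f2//= ltn_ord.
Qed.

End symmetric_sums.

(** * Trigonometric sums and their limits *)

Section psum.
Context {R : realType}.
Implicit Types (a : R -> R) (x u : R).

(** The partial sums whose limit is phi a. *)
Definition psum a (n : nat) x : R[i] := \sum_(i < (2 * n).+1)
  (a (i%:R - n%:R))%:C%C * cexpi ((i%:R - n%:R) * x).

Lemma psum_ext a b n x : (forall t : R, a t = b t) -> psum a n x = psum b n x.
Proof. by move=> ab; rewrite /psum; under eq_bigr do rewrite ab. Qed.

Lemma psumB a b n x : psum (fun t => a t - b t) n x = psum a n x - psum b n x.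
Proof.
by rewrite /psum -sumrB; apply: eq_bigr => i _; rewrite rmorphB/= mulrBl.
Qed.

Lemma psumE a n x :
  psum a n x = (a 0)%:C%C + \sum_(k < n)
    ((a k.+1%:R)%:C%C * cexpi (k.+1%:R * x) +
     (a (- k.+1%:R))%:C%C * cexpi (- k.+1%:R * x)).
Proof.
rewrite /psum (sum_symm (fun j : R => (a j)%:C%C * cexpi (j * x))).
by rewrite mul0r cexpi0 mulr1.
Qed.

Lemma psum_stable a m n x : (m <= n)%N ->
  (forall t, m%:R < `|t| -> a t = 0) -> psum a n x = psum a m x.
Proof.
move=> mn a0; rewrite !psumE -(subnKC mn) big_split_ord/=.
rewrite [X in _ + (_ + X)]big1 ?addr0// => k _.
rewrite !a0 ?mul0r ?addr0// ?normrN ger0_norm ?ler0n// ltr_nat ltnS leq_addr//.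
Qed.

Lemma normc_psum_le a n x (b : nat -> R) :
  (forall k : nat, (k <= n)%N -> `|a k%:R| <= b k) ->
  (forall k : nat, (k <= n)%N -> `|a (- k%:R)| <= b k) ->
  normc (psum a n x) <= 2 * \sum_(k < n.+1) b k.
Proof.
move=> a1 a2; apply: (le_trans (normc_sum _ _ _)).
have b0 k : (k <= n)%N -> 0 <= b k by move=> /a1; apply: le_trans.
pose b' k := if (k <= n)%N then b k else 0.
have -> : \sum_(k < n.+1) b k = \sum_(k < n.+1) b' k.
  by apply: eq_bigr => k _; rewrite /b' -ltnS ltn_ord.
rewrite (@le_trans _ _ (\sum_(i < (2 * n).+1) `|a (i%:R - n%:R)|))//.
  apply: ler_sum => i _.
  by rewrite ComplexField.Normc.normcM normc_cexpi mulr1 normc_real.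
apply: (@ler_sum_symm R (fun t => `|a t|) b') => k.
- by move=> kn; rewrite /b' kn a1.
- by move=> kn; rewrite /b' kn a2.
- by rewrite /b'; case: ifPn => // /b0.
Qed.

(** Two summations by parts: multiplying by 2 - 2 cos u differentiates the
    symbol twice, up to the terms at the ends of the range. *)
Lemma psum_second_difference a n u :
  (2 - 2 * cos u)%:C%C * psum a n u =
  psum (fun t => 2 * a t - a (t - 1) - a (t + 1)) n u +
  (((a (n%:R + 1))%:C%C * cexpi (n%:R * u) -
    (a n%:R)%:C%C * cexpi ((n%:R + 1) * u)) -
   ((a (- n%:R))%:C%C * cexpi ((- n%:R - 1) * u) -
    (a (- n%:R - 1))%:C%C * cexpi (- n%:R * u))).
Proof.
pose U (i : nat) : R[i] :=
  (a (i%:R - n%:R))%:C%C * cexpi ((i%:R - n%:R - 1) * u) -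
  (a (i%:R - n%:R - 1))%:C%C * cexpi ((i%:R - n%:R) * u).
have -> : ((a (n%:R + 1))%:C%C * cexpi (n%:R * u) -
    (a n%:R)%:C%C * cexpi ((n%:R + 1) * u)) -
   ((a (- n%:R))%:C%C * cexpi ((- n%:R - 1) * u) -
    (a (- n%:R - 1))%:C%C * cexpi (- n%:R * u)) =
   \sum_(i < (2 * n).+1) (U i.+1 - U i).
  rewrite -(big_mkord xpredT (fun i => U i.+1 - U i)) telescope_sumr// /U.
  have -> : (2 * n).+1%:R - n%:R = n%:R + 1 :> R.
    by rewrite -natr1 natrM; ring.
  by rewrite addrK sub0r.
rewrite /psum mulr_sumr -big_split/=; apply: eq_bigr => i _.
rewrite /U.
set j : R := i%:R - n%:R.
have -> : i.+1%:R - n%:R = j + 1 by rewrite -natr1 /j; ring.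
have -> : (j + 1) * u = j * u + u by ring.
have -> : (j + 1 - 1) = j by ring.
have -> : (j - 1) * u = j * u + - u by ring.
rewrite !cexpiD.
have -> : (2 - 2 * cos u)%:C%C = 2 - cexpi u - cexpi (- u) :> R[i].
  apply/eqP; rewrite eq_complex /= cosN sinN.
  by apply/andP; split; apply/eqP; ring.
rewrite !rmorphB rmorphM/= rmorph_nat; ring.
Qed.

Lemma normc_psum_second_difference a n u :
  (2 - 2 * cos u) * normc (psum a n u) <=
  normc (psum (fun t => 2 * a t - a (t - 1) - a (t + 1)) n u) +
  (`|a (n%:R + 1)| + `|a n%:R| + `|a (- n%:R)| + `|a (- (n%:R + 1))|).
Proof.
have h : 0 <= 2 - 2 * cos u by have := cos_le1 u; lra.
have /(congr1 (@normc R)) := psum_second_difference a n u.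
rewrite ComplexField.Normc.normcM normc_real ger0_norm// => ->.
rewrite (le_trans (le_normcD _ _))// lerD2l.
have le_normcB (z1 z2 : R[i]) : normc (z1 - z2) <= normc z1 + normc z2.
  by rewrite -(normcN z2) le_normcD.
have nM (b y : R) : normc (b%:C%C * cexpi y) = `|b|.
  by rewrite ComplexField.Normc.normcM normc_cexpi mulr1 normc_real.
rewrite (le_trans (le_normcB _ _))// -addrA lerD//.
  by rewrite (le_trans (le_normcB _ _))// !nM.
by rewrite (le_trans (le_normcB _ _))// !nM -opprD.
Qed.

End psum.

Section complex_limits.
Context {R : realType}.
Implicit Types (u v : nat -> R[i]) (l z : R[i]).

Definition ccvg u l :=
  (fun n => complex.Re (u n)) @ \oo --> complex.Re l /\
  (fun n => complex.Im (u n)) @ \oo --> complex.Im l.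

Lemma ccvg_climn u l : ccvg u l -> climn u = l.
Proof.
case: l => a b [/= h1 h2]; rewrite /climn.
by congr Complex; apply: cvg_lim.
Qed.

Lemma ccvg_cst z : ccvg (fun=> z) z.
Proof. by split; apply: cvg_cst. Qed.

Lemma ccvgD u v l l' : ccvg u l -> ccvg v l' ->
  ccvg (fun n => u n + v n) (l + l').
Proof.
case: l l' => [a b] [a' b'] [/= h1 h2] [/= h3 h4]; split => /=.
  rewrite (_ : (fun n => _) = (fun n => complex.Re (u n) + complex.Re (v n))).
    exact: cvgD.
  by apply/funext => n; case: (u n); case: (v n).
rewrite (_ : (fun n => _) = (fun n => complex.Im (u n) + complex.Im (v n))).
  exact: cvgD.
by apply/funext => n; case: (u n); case: (v n).
Qed.

Lemma ccvgMl z u l : ccvg u l -> ccvg (fun n => z * u n) (z * l).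
Proof.
case: z l => [c d] [a b] [/= h1 h2]; split => /=.
  rewrite (_ : (fun n => _) =
      (fun n => c * complex.Re (u n) - d * complex.Im (u n))).
    by apply: cvgB; apply: cvgMr.
  by apply/funext => n; case: (u n).
rewrite (_ : (fun n => _) =
    (fun n => c * complex.Im (u n) + d * complex.Re (u n))).
  by apply: cvgD; apply: cvgMr.
by apply/funext => n; case: (u n).
Qed.

Lemma ccvgB u v l l' : ccvg u l -> ccvg v l' ->
  ccvg (fun n => u n - v n) (l - l').
Proof.
move=> ul /(ccvgMl (-1)) vl; have := ccvgD ul vl; rewrite mulN1r.
by under eq_fun do rewrite mulN1r.
Qed.

Lemma ccvg_sum (I : Type) (s : seq I) (f : I -> nat -> R[i]) (l : I -> R[i]) :
  (forall i, ccvg (f i) (l i)) ->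
  ccvg (fun n => \sum_(i <- s) f i n) (\sum_(i <- s) l i).
Proof.
move=> h; elim: s => [|i s IH].
  by rewrite big_nil; under eq_fun do rewrite big_nil; exact: ccvg_cst.
by rewrite big_cons; under eq_fun do rewrite big_cons; exact: ccvgD.
Qed.

(** The limit is taken in each component separately, whence the factor 2. *)
Lemma normc_ccvg_le u l (B : R) (n0 : nat) : ccvg u l ->
  (forall n, (n0 <= n)%N -> normc (u n) <= B) -> normc l <= 2 * B.
Proof.
move=> [h1 h2] uB; rewrite (le_trans (normc_le_ReIm _))//.
rewrite mulr_natl mulr2n lerD//.
  rewrite -(cvg_lim _ (cvg_norm h1))//; apply: limr_le.
    by apply: cvgP; exact: cvg_norm h1.
  near=> n; rewrite (le_trans (Re_le_normc _))// uB//.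
  by near: n; exists n0.
rewrite -(cvg_lim _ (cvg_norm h2))//; apply: limr_le.
  by apply: cvgP; exact: cvg_norm h2.
near=> n; rewrite (le_trans (Im_le_normc _))// uB//.
by near: n; exists n0.
Unshelve. all: by end_near. Qed.

Lemma bounded_sum_cvgn (f : nat -> R) (B : R) :
  (forall n, \sum_(k < n) `|f k| <= B) -> cvgn (fun n => \sum_(k < n) f k).
Proof.
move=> fB.
rewrite (_ : (fun n => _) = series f); last first.
  by apply/funext => n; rewrite /series/= big_mkord.
apply: normed_cvg; apply: nondecreasing_is_cvgn.
  by apply/nondecreasing_seqP => n; rewrite -subr_ge0 seriesSB /=.
exists B => _ [n _ <-]; apply: le_trans (fB n).
by rewrite -(big_mkord xpredT (fun k => `|f k|)).
Qed.

Lemma ccvg_psum (a : R -> R) (B : R) x :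
  (forall n, \sum_(k < n) (`|a k.+1%:R| + `|a (- k.+1%:R)|) <= B) ->
  ccvg (fun n => psum a n x) (phi a x).
Proof.
move=> aB.
pose c k : R[i] := (a k.+1%:R)%:C%C * cexpi (k.+1%:R * x) +
     (a (- k.+1%:R))%:C%C * cexpi (- k.+1%:R * x).
have cB k : normc (c k) <= `|a k.+1%:R| + `|a (- k.+1%:R)|.
  rewrite (le_trans (le_normcD _ _))// !ComplexField.Normc.normcM.
  by rewrite !normc_cexpi !mulr1 !normc_real.
have ReE n : complex.Re (psum a n x) = a 0 + \sum_(k < n) complex.Re (c k).
  by rewrite psumE ReD (big_morph _ (@ReD R) (erefl : complex.Re 0 = 0)).
have ImE n : complex.Im (psum a n x) = \sum_(k < n) complex.Im (c k).
  by rewrite psumE ImD (big_morph _ (@ImD R) (erefl : complex.Im 0 = 0))/= add0r.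
have cvRe : cvgn (fun n => complex.Re (psum a n x)).
  under eq_fun do rewrite ReE.
  suff h : cvgn (fun n => \sum_(k < n) complex.Re (c k)).
    exact: (is_cvgD (is_cvg_cst (a 0)) h).
  apply: (@bounded_sum_cvgn (fun k => complex.Re (c k)) B) => n;
      apply: le_trans (aB n).
  by apply: ler_sum => k _; rewrite (le_trans (Re_le_normc _)).
have cvIm : cvgn (fun n => complex.Im (psum a n x)).
  under eq_fun do rewrite ImE.
  apply: (@bounded_sum_cvgn (fun k => complex.Im (c k)) B) => n;
      apply: le_trans (aB n).
  by apply: ler_sum => k _; rewrite (le_trans (Im_le_normc _)).
by split.
Qed.

Lemma normc_phi_le (a : R -> R) (B : R) x :
  (forall n, \sum_(k < n) (`|a k.+1%:R| + `|a (- k.+1%:R)|) <= B) ->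
  normc (phi a x) <= 2 * (`|a 0| + B).
Proof.
move=> aB; apply: (normc_ccvg_le (n0 := 0%N) (ccvg_psum x aB)) => n _.
rewrite psumE (le_trans (le_normcD _ _))// normc_real lerD2l.
apply: le_trans (aB n); apply: (le_trans (normc_sum _ _ _)).
apply: ler_sum => k _; rewrite (le_trans (le_normcD _ _))//.
by rewrite !ComplexField.Normc.normcM !normc_cexpi !mulr1 !normc_real.
Qed.

Lemma phi_finite (a : R -> R) (m : nat) x :
  (forall t, m%:R < `|t| -> a t = 0) -> phi a x = psum a m x.
Proof.
move=> a0; apply: ccvg_climn.
have h n : (m <= n)%N -> psum a n x = psum a m x.
  by move=> mn; exact: psum_stable.
split; apply: cvg_near_cst; exists m => // n /= mn; rewrite -/(psum a n x) h//.
Qed.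

End complex_limits.

(** * The weight and its power envelopes *)

Section weight.
Context {R : realType}.
Variables (r kappa : R).

Definition weight (t : R) : R := t `^ (- r) * ln (t + 1) `^ (- kappa).

Lemma ln1D_gt0 (t : R) : 2^-1 <= t -> 0 < ln (t + 1).
Proof. by move=> t2; apply: ln_gt0; lra. Qed.

Lemma weightE (t : R) : 2^-1 <= t ->
  weight t = expR (- r * ln t - kappa * ln (ln (t + 1))).
Proof.
move=> t2; have L0 := ln1D_gt0 t2.
by rewrite /weight /powR gt_eqF ?(gt_eqF L0) -?expRD ?mulNr//; lra.
Qed.

Lemma weight_gt0 (t : R) : 2^-1 <= t -> 0 < weight t.
Proof. by move=> t2; rewrite weightE// expR_gt0. Qed.

(** The logarithmic factor varies more slowly than any power: in the scale of
    ln t, the function ln (ln (t + 1)) has an arbitrarily small Lipschitz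
    constant, up to an additive constant. *)
Lemma lnln_slow (delta : R) : 0 < delta ->
  exists K : R, forall x y : R, 2^-1 <= x -> 2^-1 <= y ->
    `|ln (ln (x + 1)) - ln (ln (y + 1))| <= K + delta * `|ln x - ln y|.
Proof.
move=> d0.
have l00 : 0 < ln (2^-1 + 1) :> R by apply: ln1D_gt0.
pose q : R := 1 + (delta * ln (2^-1 + 1))^-1.
have q0 : 0 < q by rewrite ltr_pwDl// invr_ge0 mulr_ge0// ltW.
exists (ln q) => x y.
wlog yx : x y / y <= x => [hw x2 y2|x2 y2].
  have [|/ltW] := leP y x; first by move=> yx; exact: hw.
  by move=> xy; rewrite distrC (distrC (ln x)); exact: hw.
have [Lx Ly] := (ln1D_gt0 x2, ln1D_gt0 y2).
have Lyx : ln (y + 1) <= ln (x + 1) by rewrite ler_ln ?posrE; lra.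
have lyx : ln y <= ln x by rewrite ler_ln ?posrE; lra.
rewrite !ger0_norm ?subr_ge0 ?ler_ln ?posrE//; try lra.
set D := ln x - ln y.
have D0 : 0 <= D by rewrite subr_ge0.
have LxD : ln (x + 1) <= ln (y + 1) + D.
  rewrite /D -(ln_div (x := x)) ?posrE; [|lra|lra].
  have xy0 : 0 < x / y by rewrite divr_gt0//; lra.
  rewrite -lnM ?posrE//; last lra.
  rewrite ler_ln ?posrE; [|lra|by rewrite mulr_gt0//; lra].
  have xy1 : 1 <= x / y by rewrite ler_pdivlMr; lra.
  rewrite mulrDl mul1r mulrCA divff ?mulr1; lra.
have l0y : ln (2^-1 + 1) <= ln (y + 1) by rewrite ler_ln ?posrE; lra.
have e1 : delta * D <= expR (delta * D) by have := expR_ge1Dx (delta * D); lra.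
have e2 : 1 <= expR (delta * D).
  have := expR_ge1Dx (delta * D); have :
      0 <= delta * D by rewrite mulr_ge0// ltW. lra.
have : ln (x + 1) <= ln (y + 1) * (expR (delta * D) * q).
  apply: (le_trans LxD); rewrite /q.
  set z := (delta * ln (2^-1 + 1))^-1.
  have z0 : 0 < z by rewrite invr_gt0 mulr_gt0.
  have h1 : D <= expR (delta * D) * z * ln (y + 1).
    rewrite [leLHS](_ : _ = (delta * D) * z * ln (2^-1 + 1)).
      by rewrite ler_pM// ?mulr_ge0 ?ler_wpM2r//; lra.
    by rewrite /z; field; rewrite !gt_eqF.
  have : ln (y + 1) <= ln (y + 1) * expR (delta * D) by rewrite ler_peMr// ltW.
  move: h1; set E := expR _; set L := ln (y + 1) => h1 h2.
  by rewrite (_ : L * _ = L * E + E * z * L) ?lerD//; ring.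
have E0 := expR_gt0 (delta * D).
rewrite -ler_ln ?posrE ?mulr_gt0// lnM ?posrE ?mulr_gt0// lnM ?posrE// expRK.
lra.
Qed.

(** Potter's bound for a regularly varying function: up to an arbitrarily small
    power, two values compare like the pure power. Written with exponentials of
    logarithms it covers both orders of x and y. *)
Lemma weight_potter (eps : R) : 0 < eps ->
  exists2 C : R, 0 < C & forall x y : R, 2^-1 <= x -> 2^-1 <= y ->
    weight x <= C * weight y *
      expR (r * (ln y - ln x) + eps * `|ln x - ln y|).
Proof.
move=> e0; have k1 : 0 < `|kappa| + 1 by rewrite ltr_wpDl.
have [K hK] := lnln_slow (divr_gt0 e0 k1).
exists (expR (`|kappa| * K)); first exact: expR_gt0.
move=> x y x2 y2; rewrite !weightE// -!expRD ler_expR.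
have {hK} := hK x y x2 y2.
set X := ln (ln (x + 1)); set Y := ln (ln (y + 1)).
set D := `|ln x - ln y| => hK.
have D0 : 0 <= D by exact: normr_ge0.
have : - (kappa * (X - Y)) <= `|kappa| * (K + eps / (`|kappa| + 1) * D).
  rewrite (le_trans (ler_norm _))// normrN normrM ler_wpM2l//.
have : `|kappa| * (eps / (`|kappa| + 1) * D) <= eps * D.
  rewrite mulrA ler_wpM2r// mulrCA -[leRHS]mulr1 ler_pM2l//.
  by rewrite ler_pdivrMr// mul1r lerDl.
lra.
Qed.

End weight.

Section power_sums.
Context {R : realType}.

(** The shape of all the envelopes below: flat up to m, then decaying like a
    power. *)
Definition plateau (rho m t : R) : R := (m / Num.max m t) `^ rho.

Lemma plateau_ge0 (rho m t : R) : 0 <= plateau rho m t.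
Proof. exact: powR_ge0. Qed.

Lemma plateau_le1 (rho m t : R) : 0 <= rho -> 0 < m -> plateau rho m t <= 1.
Proof.
move=> r0 m0; have M0 : 0 < Num.max m t by rewrite lt_max m0.
apply: (@le_trans _ _ (1 `^ rho)); last by rewrite powR1.
rewrite ge0_ler_powR ?nnegrE ?divr_ge0 ?(ltW m0) ?(ltW M0)//.
by rewrite ler_pdivrMr// mul1r le_max lexx.
Qed.

Lemma plateauE (rho m t : R) : 0 < m -> m <= t ->
  plateau rho m t = expR (rho * (ln m - ln t)).
Proof.
move=> m0 mt; have t0 : 0 < t by exact: lt_le_trans mt.
by rewrite /plateau max_r// /powR gt_eqF ?divr_gt0// ln_div ?posrE.
Qed.

(** Bernoulli's inequality for the exponent 1 - rho makes the sum over t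
    telescope. *)
Lemma plateau_telescope (rho m t : R) : 1 < rho -> 0 < m -> m <= t ->
  (rho - 1) * plateau rho m (t + 1) <=
  m * (plateau (rho - 1) m t - plateau (rho - 1) m (t + 1)).
Proof.
move=> rho1 m0 mt; have t0 : 0 < t by exact: lt_le_trans mt.
have t10 : 0 < t + 1 by lra.
rewrite !plateauE//; try lra.
set L := ln (t + 1).
have -> : expR (rho * (ln m - L)) =
          expR ((rho - 1) * (ln m - L)) * (m / (t + 1)).
  rewrite -[m / _]lnK ?posrE ?divr_gt0// -expRD ln_div ?posrE//.
  by congr expR; rewrite -/L; ring.
have -> : expR ((rho - 1) * (ln m - ln t)) =
          expR ((rho - 1) * (ln m - L)) * expR ((rho - 1) * (L - ln t)).
  by rewrite -expRD; congr expR; ring.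
set E := expR ((rho - 1) * (ln m - L)); have E0 : 0 < E by exact: expR_gt0.
have hL : (t + 1)^-1 <= L - ln t.
  have : ln (t / (t + 1)) <= - (t + 1)^-1.
    have -> : t / (t + 1) = 1 + (- (t + 1)^-1) by field; lra.
    apply: le_ln1Dx; rewrite ltrN2 invf_lt1//; lra.
  by rewrite ln_div ?posrE// -/L; lra.
have := expR_ge1Dx ((rho - 1) * (L - ln t)).
set F := expR _ => hF.
rewrite (_ : (rho - 1) * (E * (m / (t + 1))) = E * m * ((rho - 1) * (t + 1)^-1));
  last by ring.
rewrite (_ : m * (E * F - E) = E * m * (F - 1)); last by ring.
rewrite ler_pM2l ?mulr_gt0//.
apply: le_trans (_ : (rho - 1) * (L - ln t) <= _); last lra.
by rewrite ler_pM2l//; lra.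
Qed.

Lemma plateau_sum (rho : R) (m n : nat) : 1 < rho -> (0 < m)%N ->
  \sum_(k < n) plateau rho m%:R k%:R <= (2 + (rho - 1)^-1) * m%:R.
Proof.
move=> rho1 m0; have m0' : 0 < m%:R :> R by rewrite ltr0n.
have m1' : 1 <= m%:R :> R by rewrite ler1n.
have r0 : 0 < rho - 1 by lra.
have h1 k : plateau rho m%:R k%:R <= 1 by apply: plateau_le1; lra.
have small p : (p <= m.+1)%N ->
    \sum_(k < p) plateau rho m%:R k%:R <= 2 * m%:R.
  move=> pm; apply: (@le_trans _ _ (\sum_(k < p) 1)); first exact: ler_sum.
  rewrite sumr_const card_ord (@le_trans _ _ m.+1%:R)// ?ler_nat//.
  by rewrite -natr1; lra.
have large d : \sum_(k < m.+1 + d) plateau rho m%:R k%:R <=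
    2 * m%:R + m%:R / (rho - 1) * (1 - plateau (rho - 1) m%:R (m + d)%:R).
  elim: d => [|d IH].
    rewrite !addn0 (le_trans (small _ _))// lerDl mulr_ge0//.
      by rewrite divr_ge0// ltW.
    by rewrite subr_ge0 plateau_le1// ltW.
  rewrite !addnS big_ord_recr/= -/(_ + _).
  rewrite (le_trans (lerD IH (lexx _)))// -addrA lerD2l.
  have mt : m%:R <= (m + d)%:R :> R by rewrite ler_nat leq_addr.
  have := plateau_telescope rho1 m0' mt.
  rewrite natr1 -addnS => h.
  rewrite -lerBrDl -mulrBr -(ler_pM2l r0).
  rewrite [leRHS](_ : _ = m%:R * (plateau (rho - 1) m%:R (m + d)%:R -
    plateau (rho - 1) m%:R (m + d.+1)%:R)); last by field; rewrite gt_eqF.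
  by rewrite addSn -addnS.
have c0 : 0 <= m%:R / (rho - 1) by rewrite divr_ge0// ltW.
have cE : (2 + (rho - 1)^-1) * m%:R = 2 * m%:R + m%:R / (rho - 1) by ring.
have [/small h|/ltnW/subnKC <-] := leqP n m.+1.
  by rewrite (le_trans h)// cE lerDl.
rewrite (le_trans (large _))// cE lerD2l -[leRHS]mulr1 ler_wpM2l//.
by rewrite lerBlDr lerDl plateau_ge0.
Qed.

Lemma expR_sum (s : R) (n : nat) : 0 < s ->
  \sum_(k < n) expR (- s * k%:R) <= (1 - expR (- s))^-1.
Proof.
move=> s0; pose q := expR (- s).
have q1 : q < 1 by rewrite expR_lt1; lra.
have q0 : 0 < q by exact: expR_gt0.
have -> : \sum_(k < n) expR (- s * k%:R) = \sum_(k < n) q ^+ k.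
  by apply: eq_bigr => k _; rewrite mulrC expRM_natl.
rewrite -[leRHS]div1r ler_pdivlMr ?subr_gt0//.
have := subrX1 q n; have : 0 <= q ^+ n by rewrite exprn_ge0// ltW.
rewrite -/q; nra.
Qed.

End power_sums.

Section weight_bounds.
Context {R : realType}.
Variables (r kappa : R).

(** Potter's bound costs an arbitrarily small power of t / m; half of the room
    between r and 1 is spent on it, which leaves a summable envelope. *)
Lemma weight_tail : 1 < r -> exists2 C : R, 0 < C & forall m t : R, 1 <= m ->
    m / 2 <= t ->
  weight r kappa t <= C * weight r kappa m * plateau ((r + 1) / 2) m t.
Proof.
move=> r1; pose eps := (r - 1) / 2; have e0 : 0 < eps by rewrite /eps; lra.
have [C C0 hC] := weight_potter r kappa e0.
exists (C * expR ((r + eps) * ln 2)); first by rewrite mulr_gt0 ?expR_gt0.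
move=> m t m1 tm; have t2 : 2^-1 <= t by lra.
have m2 : 2^-1 <= m by lra.
apply: (le_trans (hC _ _ t2 m2)).
have : 0 < weight r kappa m by exact: weight_gt0.
move: (weight r kappa m) => W W0; rewrite (mulrAC C _ W) -[leRHS]mulrA ler_pM2l
    ?mulr_gt0//.
have l2 : 0 <= ln 2 :> R by apply: ln_ge0; lra.
have [mt|mt] := leP m t.
  have lmt : ln m <= ln t by rewrite ler_ln ?posrE; lra.
  rewrite plateauE//; last lra.
  rewrite -expRD ler_expR ger0_norm ?subr_ge0//.
  apply: (@le_trans _ _ ((r + 1) / 2 * (ln m - ln t))).
    by rewrite /eps; lra.
  by rewrite lerDr mulr_ge0//; lra.
rewrite /plateau max_l; last exact: ltW.
rewrite divff ?powR1 ?mulr1; last by rewrite gt_eqF//; lra.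
have lmt : ln t <= ln m by rewrite ler_ln ?posrE; lra.
have : ln m - ln t <= ln 2.
  have h : ln m <= ln (2 * t) by rewrite ler_ln ?posrE; lra.
  by move: h; rewrite lnM ?posrE; lra.
rewrite ler_expR ler0_norm; last lra.
move=> h; rewrite (_ : _ + _ = (r + eps) * (ln m - ln t)); last by ring.
by rewrite ler_pM2l//; lra.
Qed.

(** Below m the weight may be much larger than at m, but any exponential gain
    in the distance to m makes up for it. *)
Lemma weight_head (s : R) : 1 < r -> 0 < s ->
  exists2 C : R, 0 < C & forall m j : R, 1 <= j -> j <= m ->
    weight r kappa j * expR (- s * (m - j)) <=
    C * weight r kappa m * expR (- (s / 2) * (m - j)).
Proof.
move=> r1 s0; pose eps := (r - 1) / 2; have e0 : 0 < eps by rewrite /eps; lra.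
have [C C0 hC] := weight_potter r kappa e0.
pose sg := r + eps; have sg0 : 0 < sg by rewrite /sg; lra.
pose a := s / 2 / sg; have a0 : 0 < a by rewrite !divr_gt0.
pose c := Num.min 1 a; have c0 : 0 < c by rewrite lt_min ltr01.
have c1 : c <= 1 by rewrite ge_min lexx.
have ca : c <= a by rewrite ge_min lexx orbT.
exists (C * expR (- sg * ln c)); first by rewrite mulr_gt0 ?expR_gt0.
move=> m j j1 jm; set i := m - j; have i0 : 0 <= i by rewrite subr_ge0.
have [j2 m2] : 2^-1 <= j /\ 2^-1 <= m by split; lra.
have ljm : ln j <= ln m by rewrite ler_ln ?posrE; lra.
have := hC _ _ j2 m2; rewrite ler0_norm; last lra.
rewrite (_ : _ + _ = sg * (ln m - ln j)); last by rewrite /sg; ring.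
move=> h; rewrite (le_trans (ler_wpM2r (expR_ge0 _) h))//.
have : 0 < weight r kappa m by exact: weight_gt0.
move: (weight r kappa m) => W W0.
rewrite (mulrAC C _ W) -[leLHS]mulrA -[leRHS]mulrA ler_pM2l ?mulr_gt0//.
rewrite -!expRD ler_expR.
have h1 : ln m - ln j <= ln (1 + i).
  rewrite lerBlDr -lnM ?posrE ?ler_ln ?posrE//; try lra; last nra.
  by rewrite /i; nra.
have h2 : ln c + ln (1 + i) <= a * i.
  rewrite -lnM ?posrE//; last lra.
  rewrite -[leRHS]expRK ler_ln ?posrE ?expR_gt0 ?mulr_gt0//; last lra.
  by have := expR_ge1Dx (a * i); nra.
have sa : sg * a = s / 2 by rewrite /a; field; rewrite gt_eqF.
have : sg * (ln m - ln j) <= sg * (a * i - ln c).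
  by rewrite ler_pM2l//; lra.
rewrite (_ : sg * (a * i - ln c) = s / 2 * i - sg * ln c); last first.
  by rewrite mulrBr mulrA sa.
lra.
Qed.

End weight_bounds.

(** * Derivatives and symbol estimates *)

Section derivatives.
Context {R : realType}.
Implicit Types f g : R -> R.

Lemma is_deriveM1 f g (x df dg : R) :
  is_derive x 1 f df -> is_derive x 1 g dg ->
  is_derive x 1 (fun t => f t * g t) (df * g x + f x * dg).
Proof.
move=> hf hg; have h := is_deriveM hf hg; apply: (is_derive_eq h).
by rewrite /GRing.scale/= addrC (mulrC (g x)).
Qed.

Lemma is_derive_scale_arg f (c x df : R) :
  is_derive (x * c) 1 f df -> is_derive x 1 (fun t => f (t * c)) (df * c).
Proof.
move=> hf.
have hg : is_derive x 1 (fun t : R => t * c) c.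
  have := is_deriveM1 (is_derive_id x 1) (is_derive_cst c x 1).
  by rewrite mul1r mulr0 addr0.
exact: (@is_derive1_comp _ f (fun t => t * c) x df c hf hg).
Qed.

Lemma derive1_is_derive f (x : R) : derivable f x 1 ->
    is_derive x 1 f (derive1 f x).
Proof. by move=> h; rewrite derive1E; exact/derivableP. Qed.

Lemma derive1_eqfun f g (x : R) : (\near x, f x = g x) ->
  derive1 f x = derive1 g x.
Proof. by move=> fg; rewrite !derive1E; exact: near_eq_derive. Qed.

Lemma derive1_oppr f (x : R) : derivable f (- x) 1 ->
  derive1 (fun t => f (- t)) x = - derive1 f (- x).
Proof.
move=> /derive1_is_derive h.
rewrite -[- x]mulrN1 in h; have := is_derive_scale_arg h.
rewrite mulrN1 (_ : (fun t => f (t * -1)) = (fun t => f (- t))).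
  by move=> hh; rewrite [LHS]derive1E; rewrite derive_val mulrN1.
by apply/funext => t; rewrite mulrN1.
Qed.

Lemma continuous_bounded f (a b : R) : a <= b ->
  (forall t, a <= t <= b -> {for t, continuous f}) ->
  exists2 C : R, 0 < C & forall t, a <= t <= b -> `|f t| <= C.
Proof.
move=> ab cf.
have cf' : {within `[a, b], continuous (fun t => `|f t|)}.
  apply: continuous_in_subspaceT => t; rewrite inE/= in_itv/= => tab.
  by apply: continuous_comp; [exact: cf|exact: norm_continuous].
have [c _ hc] := EVT_max ab cf'.
exists (`|f c| + 1); first by rewrite ltr_wpDl.
move=> t tab; rewrite (le_trans (hc t _)) ?in_itv//= lerDl//.
Qed.

(** By the mean value theorem, applied to f(. + 1) - f and then to f'. *)
Lemma second_difference_derive f f1 f2 (x : R) :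
  (forall t : R, is_derive t 1 f (f1 t)) -> (forall t :
      R, is_derive t 1 f1 (f2 t)) ->
  exists2 d : R, `|d - x| <= 1 & 2 * f x - f (x - 1) - f (x + 1) = - f2 d.
Proof.
move=> hf hf1.
have df t : derivable f t 1 by case: (hf t).
have df1 t : derivable f1 t 1 by case: (hf1 t).
have cts g (a b : R) : (forall t : R, derivable g t 1) ->
    {within `[a, b], continuous g}.
  by move=> dg; apply: derivable_within_continuous => t _; exact: dg.
have hg (t : R) : is_derive t 1 (fun t => f (t + 1) - f t) (f1 (t + 1) - f1 t).
  have h1 : is_derive t 1 (fun t => f (t + 1)) (f1 (t + 1)).
    have hid : is_derive t 1 (fun t : R => t + 1) 1.
      have := is_deriveD (is_derive_id t 1) (is_derive_cst (1:R) t 1).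
      by rewrite addr0.
    have := @is_derive1_comp _ f (fun t => t + 1) t _ _ (hf (t + 1)) hid.
    by rewrite mulr1.
  exact: is_deriveB.
have [c] := @MVT _ _ (fun t => f1 (t + 1) - f1 t) (x - 1) x
  (ltac:(lra)) (fun t _ => hg t) (cts _ _ _ (fun t =>
      ex_derive (is_derive := hg t))).
rewrite in_itv/= => /andP[c1 c2] hc.
have [d] := @MVT _ _ f2 c (c + 1) (ltac:(lra)) (fun t _ => hf1 t) (cts _ _ _ df1).
rewrite in_itv/= => /andP[d1 d2] hd.
exists d; first by rewrite ler_norml; apply/andP; split; lra.
move: hc; rewrite hd subrK; lra.
Qed.

End derivatives.

Section symbols.
Context {R : realType}.
Implicit Types (f g v : R -> R).

(** Beyond T, the derivatives of order k <= 2 are of order v(t) / t^k: the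
    classical symbol estimates. They are stable under products, which
    saves differentiating the three factors of a mask jointly. *)
Definition symbol (T : R) v f := exists f1 f2 (C : R), 0 <= C /\
  forall t : R, T < t ->
  [/\ is_derive t 1 f (f1 t), is_derive t 1 f1 (f2 t) &
   [/\ `|f t| <= C * v t, `|t * f1 t| <= C * v t & `|t ^+ 2 * f2 t| <= C * v t]].

Lemma symbol_mono (T T' : R) v f : T <= T' -> symbol T v f -> symbol T' v f.
Proof.
move=> TT [f1 [f2 [C [C0 h]]]]; exists f1, f2, C; split=> // t Tt.
by apply: h; exact: le_lt_trans Tt.
Qed.

Lemma symbolM (T : R) v w f g : symbol T v f -> symbol T w g ->
  symbol T (fun t => v t * w t) (fun t => f t * g t).
Proof.
move=> [f1 [f2 [C [C0 hf]]]] [g1 [g2 [D [D0 hg]]]].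
exists (fun t => f1 t * g t + f t * g1 t).
exists (fun t => (f2 t * g t + f1 t * g1 t) + (f1 t * g1 t + f t * g2 t)).
exists (4 * (C * D)); split; first by rewrite !mulr_ge0.
move=> t Tt.
have [df df1 [f0b f1b f2b]] := hf t Tt; have [dg dg1 [g0b g1b g2b]] := hg t Tt.
split.
- exact: is_deriveM1.
- by apply: is_deriveD; exact: is_deriveM1.
have P (x y : R) : `|x| <= C * v t -> `|y| <= D * w t ->
    `|x * y| <= C * D * (v t * w t).
  by move=> hx hy; rewrite normrM mulrACA ler_pM.
have B0 : 0 <= C * D * (v t * w t) by exact: le_trans (P _ _ f0b g0b).
rewrite -(mulrA 4); split.
- by apply: (le_trans (P _ _ f0b g0b)); lra.
- rewrite (_ : t * _ = (t * f1 t) * g t + f t * (t * g1 t)); last by ring.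
  rewrite (le_trans (ler_normD _ _))//.
  by have := P _ _ f1b g0b; have := P _ _ f0b g1b; lra.
- rewrite (_ : t ^+ 2 * _ = (t ^+ 2 * f2 t) * g t + (t * f1 t) * (t * g1 t) +
    ((t * f1 t) * (t * g1 t) + f t * (t ^+ 2 * g2 t))); last by ring.
  rewrite (le_trans (ler_normD _ _))//.
  have := P _ _ f2b g0b; have := P _ _ f1b g1b; have := P _ _ f0b g2b.
  move=> h1 h2 h3.
  have := ler_normD (t ^+ 2 * f2 t * g t) (t * f1 t * (t * g1 t)).
  have := ler_normD (t * f1 t * (t * g1 t)) (f t * (t ^+ 2 * g2 t)).
  lra.
Qed.

Lemma symbol_powR (c : R) : symbol 0 (fun t => t `^ c) (fun t => t `^ c).
Proof.
exists (fun t => c * t `^ (c - 1)), (fun t => c * ((c - 1) * t `^ (c - 1 - 1))).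
exists (1 + `|c| + `|c| * `|c - 1|); split; first by rewrite !addr_ge0 ?mulr_ge0.
move=> t t0.
have p0 : 0 <= t `^ c by exact: powR_ge0.
have [c0 c1] : 0 <= `|c| /\ 0 <= `|c| * `|c - 1| by rewrite mulr_ge0.
have e0 (b : R) : t * t `^ (b - 1) = t `^ b.
  rewrite -{1}(powRr1 (ltW t0)) -powRD; first by congr (_ `^ _); ring.
  by rewrite (gt_eqF t0) implybT.
have e1 := e0 c.
have e2 : t ^+ 2 * t `^ (c - 1 - 1) = t `^ c by rewrite expr2 -mulrA !e0.
split.
- exact: is_derive1_powR.
- have := is_deriveZ c (is_derive1_powR (c - 1) t0); exact.
split.
- by rewrite ger0_norm//; nra.
- by rewrite mulrCA e1 normrM (ger0_norm p0); nra.
- rewrite mulrCA (mulrCA (t ^+ 2)) e2 !normrM (ger0_norm p0); nra.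
Qed.

Lemma symbol_ln1D (c : R) :
  symbol 1 (fun t => ln (t + 1) `^ c) (fun t => ln (t + 1) `^ c).
Proof.
pose L (t : R) := ln (t + 1).
have L0 (t : R) : 1 < t -> 0 < L t by move=> t1; apply: ln_gt0; lra.
have dsh (t : R) : is_derive t 1 (fun t : R => t + 1) 1.
  have := is_deriveD (is_derive_id t 1) (is_derive_cst (1:R) t 1).
  by rewrite addr0.
have dL (t : R) : 1 < t -> is_derive t 1 L (t + 1)^-1.
  move=> t1; have t0 : 0 < t + 1 by lra.
  have := @is_derive1_comp _ (@ln R) (fun t =>
      t + 1) t _ _ (is_derive1_ln t0) (dsh t).
  by rewrite mulr1.
have dV (t : R) : 1 < t -> is_derive t 1 (fun t : R =>
    (t + 1)^-1) (- (t + 1) ^- 2).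
  move=> t1; have t0 : t + 1 != 0 by rewrite gt_eqF//; lra.
  have := @is_deriveV _ (fun t => t + 1) t 1 1 t0 (dsh t).
  by rewrite /GRing.scale/= mulr1.
have dp (b t : R) : 1 < t ->
    is_derive t 1 (fun t => L t `^ b) (b * L t `^ (b - 1) * (t + 1)^-1).
  move=> t1.
  exact: (@is_derive1_comp _ (fun t => t `^ b) L t _ _ (is_derive1_powR b (L0 _
      t1)) (dL _ t1)).
exists (fun t => c * L t `^ (c - 1) * (t + 1)^-1).
exists (fun t => c * ((c - 1) * L t `^ (c - 1 - 1) * (t + 1)^-1) * (t + 1)^-1 +
   c * L t `^ (c - 1) * (- (t + 1) ^- 2)).
have l2 : 0 < ln 2 :> R by apply: ln_gt0; lra.
pose q : R := (ln 2)^-1; have q0 : 0 < q by rewrite invr_gt0.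
pose K := `|c| * q + `|c| * `|c - 1| * q ^+ 2.
have K0 : 0 <= K.
  by rewrite /K addr_ge0 ?mulr_ge0 ?exprn_ge0// ltW.
exists (1 + K); split; first lra.
move=> t t1; have Lt := L0 _ t1.
split.
- exact: dp.
- apply: is_deriveM1; last exact: dV.
  have := is_deriveZ c (dp (c - 1) t t1); exact.
have V0 : 0 < (t + 1)^-1 by rewrite invr_gt0; lra.
have tV0 : 0 <= t * (t + 1)^-1 by rewrite mulr_ge0// ltW//; lra.
have tV1 : t * (t + 1)^-1 <= 1 by rewrite ler_pdivrMr; lra.
have p0 : 0 <= L t `^ c by exact: powR_ge0.
have Lq : (L t)^-1 <= q.
  rewrite /q lef_pV2 ?posrE// ler_ln ?posrE; lra.
have LV0 : 0 < (L t)^-1 by rewrite invr_gt0.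
have e0 (b : R) : L t `^ (b - 1) = L t `^ b * (L t)^-1.
  rewrite -(powR_inv1 (ltW Lt)) -powRD// (gt_eqF Lt) implybT//.
have e1 := e0 c.
have e2 : L t `^ (c - 1 - 1) = L t `^ c * (L t)^-1 ^+ 2.
  by rewrite !e0 expr2 mulrA.
rewrite -/(L t) e2 e1.
move: (L t `^ c) p0 => P p0; move: (L t)^-1 Lq LV0 => Z Lq LV0.
have ZP : Z * P <= q * P by rewrite ler_wpM2r.
have Z2P : Z ^+ 2 * P <= q ^+ 2 * P.
  by rewrite ler_wpM2r// ler_sqr ?nnegrE ?(ltW LV0) ?(ltW q0).
have ZP0 : 0 <= Z * P by rewrite mulr_ge0// ltW.
have Z2P0 : 0 <= Z ^+ 2 * P by rewrite mulr_ge0// exprn_ge0// ltW.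
move: tV0 tV1; set s := t * (t + 1)^-1 => s0 s1.
have s20 : 0 <= s ^+ 2 by rewrite exprn_ge0.
have s21 : s ^+ 2 <= 1 by rewrite exprn_ile1.
have b1 : `|c * (P * Z)| <= `|c| * q * P.
  by rewrite normrM -mulrA (mulrC P) (ger0_norm ZP0) ler_wpM2l.
have b2 : `|c * (c - 1) * (P * Z ^+ 2)| <= `|c| * `|c - 1| * q ^+ 2 * P.
  rewrite normrM (normrM c) -[leRHS]mulrA (mulrC P) (ger0_norm Z2P0).
  by rewrite ler_wpM2l// mulr_ge0.
have KP : K * P = `|c| * q * P + `|c| * `|c - 1| * q ^+ 2 * P by rewrite /K
    mulrDl.
rewrite mulrDl mul1r KP.
have [n1 n2] : 0 <= `|c * (P * Z)| /\ 0 <= `|c * (c - 1) * (P * Z ^+ 2)| by [].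
split.
- by rewrite ger0_norm//; lra.
- rewrite (_ : t * _ = s * (c * (P * Z))); last by rewrite /s; ring.
  rewrite normrM (ger0_norm s0).
  by have := ler_piMl n1 s1; lra.
- rewrite (_ : t ^+ 2 * _ = s ^+ 2 * (c * (c - 1) * (P * Z ^+ 2) - c * (P * Z)));
    last by rewrite /s -exprVn; ring.
  rewrite normrM (ger0_norm s20).
  have := ler_normB (c * (c - 1) * (P * Z ^+ 2)) (c * (P * Z)).
  set N := `|_ - _| => hN.
  have := ler_piMl (normr_ge0 (c * (c - 1) * (P * Z ^+ 2) - c * (P * Z))) s21.
  rewrite -/N; lra.
Qed.

Lemma symbol_ln (F : R -> R) (T C : R) : 0 <= T ->
  (forall t : R, derivable F t 1 /\ derivable (derive1 F) t 1) ->
  (forall (k : nat) t, (k <= 2)%N -> T <= t -> `|derive1n k F t| <= C) ->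
  symbol (expR T) (fun=> 1) (F \o (@ln R)).
Proof.
move=> T0 dF FC.
have C0 : 0 <= C by exact: le_trans (FC 0%N T isT (lexx _)).
exists (fun t => derive1 F (ln t) * t^-1).
exists (fun t => derive1 (derive1 F) (ln t) * t^-1 * t^-1 +
                 derive1 F (ln t) * (- t ^- 2)).
exists (2 * C); split; first by rewrite mulr_ge0.
move=> t tT; have t0 : 0 < t by exact: lt_trans (expR_gt0 T) tT.
have lt : T <= ln t by rewrite -[T]expRK ler_ln ?posrE ?expR_gt0 ?ltW.
have dln := is_derive1_ln t0.
have dF0 := derive1_is_derive (dF (ln t)).1.
have dF1 := derive1_is_derive (dF (ln t)).2.
have tn0 : t != 0 by rewrite gt_eqF.
split.
- exact: is_derive1_comp.
- apply: is_deriveM1.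
  have := is_deriveV tn0 (is_derive_id t 1).
  by rewrite /GRing.scale/= mulr1.
have F0 : `|F (ln t)| <= C := FC 0%N _ isT lt.
have F1 : `|derive1 F (ln t)| <= C := FC 1%N _ isT lt.
have F2 : `|derive1 (derive1 F) (ln t)| <= C := FC 2%N _ isT lt.
rewrite mulr1; split => /=.
- lra.
- by rewrite mulrCA divff// mulr1; lra.
- rewrite (_ : t ^+ 2 * _ = derive1 (derive1 F) (ln t) - derive1 F (ln t));
    last by field.
  by rewrite (le_trans (ler_normB _ _))//; lra.
Qed.

End symbols.

(** * Masks and cutoffs *)

Section masks.
Context {R : realType}.
Implicit Types (f lambda theta : R -> R).

Definition D1 f : R -> R := derive1 f.
Definition D2 f : R -> R := derive1 (derive1 f).

Definition smooth2 f := forall t : R, C2_at f t.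

Lemma smooth2_D1 f (t : R) : smooth2 f -> is_derive t 1 f (D1 f t).
Proof. by move=> /(_ t)[df _ _]; exact: derive1_is_derive. Qed.

Lemma smooth2_D2 f (t : R) : smooth2 f -> is_derive t 1 (D1 f) (D2 f t).
Proof. by move=> /(_ t)[_ df _]; exact: derive1_is_derive. Qed.

Lemma smooth2_bounded f (a b : R) : a <= b -> smooth2 f ->
  exists2 C : R, 0 < C & forall t, a <= t <= b ->
    [/\ `|f t| <= C, `|D1 f t| <= C & `|D2 f t| <= C].
Proof.
move=> ab sf.
have dc g (t : R) : derivable g t 1 -> {for t, continuous g}.
  by move=> /derivable1_diffP; exact: differentiable_continuous.
have c0 t : {for t, continuous f} by have [d _ _] := sf t; exact: dc.
have c1 t : {for t, continuous (D1 f)} by have [_ d _] := sf t; exact: dc.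
have c2 t : {for t, continuous (D2 f)} by have [_ _ c] := sf t.
have [A A0 hA] := continuous_bounded ab (fun t _ => c0 t).
have [B B0 hB] := continuous_bounded ab (fun t _ => c1 t).
have [C C0 hC] := continuous_bounded ab (fun t _ => c2 t).
exists (A + B + C); first by rewrite !addr_gt0.
move=> t tab; have := hA t tab; have := hB t tab; have := hC t tab.
by move=> h1 h2 h3; split; lra.
Qed.

Lemma symbol_derive (T : R) v f g : symbol T v g -> (forall t, T < t ->
    f t = g t) ->
  exists2 C : R, 0 <= C & forall t, T < t ->
  [/\ `|f t| <= C * v t, `|t * D1 f t| <= C * v t &
      `|t ^+ 2 * D2 f t| <= C * v t].
Proof.
move=> [g1 [g2 [C [C0 h]]]] fg; exists C => // t Tt.
have E1 u : T < u -> D1 f u = g1 u.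
  move=> Tu; rewrite /D1 (@derive1_eqfun _ _ g).
    by have [dg _ _] := h u Tu; rewrite derive1E derive_val.
  by near=> z; apply: fg; near: z; exact: lt_nbhsr.
have E2 : D2 f t = g2 t.
  rewrite /D2 (@derive1_eqfun _ _ g1).
    by have [_ dg _] := h t Tt; rewrite derive1E derive_val.
  by near=> z; apply: E1; near: z; exact: lt_nbhsr.
by rewrite E1// E2 fg//; have [_ _] := h t Tt.
Unshelve. all: by end_near. Qed.

(** Far out this is the product of three symbols; on a compact interval
    away from the origin it is continuity. Negative arguments follow
    because a mask is even. *)
Lemma mask_bounds (r kappa : R) lambda : decay_mask r kappa lambda ->
  exists2 C : R, 0 < C & forall t : R, 2^-1 <= `|t| ->
  [/\ `|lambda t| <= C * weight r kappa `|t|,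
      `|t * D1 lambda t| <= C * weight r kappa `|t| &
      `|t ^+ 2 * D2 lambda t| <= C * weight r kappa `|t|].
Proof.
move=> [lE sl [F [dF lF [a1 Fa1]]]].
have [T T1 TE] : exists2 T : R, 1 <= T & T = expR 1.
  by exists (expR 1) => //; have := expR_ge1Dx (1 : R); lra.
have sg : symbol T (fun t => t `^ (- r) * ln (t + 1) `^ (- kappa) * 1)
    (fun t => t `^ (- r) * ln (t + 1) `^ (- kappa) * (F \o @ln R) t).
  apply: symbolM.
    apply: symbolM; first by apply: symbol_mono (symbol_powR _); lra.
    exact: symbol_mono (symbol_ln1D _).
  by rewrite TE; exact: (symbol_ln _ dF Fa1).
have [A A0 hA] : exists2 C : R, 0 <= C & forall t, T < t ->
  [/\ `|lambda t| <= C * weight r kappa t, `|t * D1 lambda t| <= C * weight r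
      kappa t
    & `|t ^+ 2 * D2 lambda t| <= C * weight r kappa t].
  have [|A A0 hA] := @symbol_derive T _ lambda _ sg.
    by move=> t Tt /=; rewrite lF ?ger0_norm//; lra.
  by exists A => // t /hA; rewrite mulr1.
have [B B0 hB] := @smooth2_bounded lambda 2^-1 T (ltac:(lra)) sl.
have [P P0 hP] := weight_potter r kappa (@ltr01 R).
pose S := P * expR ((`|r| + 1) * (`|ln T| + ln 2)).
have S0 : 0 < S by rewrite mulr_gt0 ?expR_gt0.
have w1 : 0 < weight r kappa 1 by apply: weight_gt0; lra.
have wS t : 2^-1 <= t <= T -> weight r kappa 1 <= S * weight r kappa t.
  move=> /andP[t2 tT]; apply: (le_trans (hP 1 t _ t2)); first lra.
  rewrite ln1 subr0 sub0r normrN /S.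
  have := weight_gt0 r kappa t2; move: (weight r kappa t) => W W0.
  rewrite (mulrAC P _ W) ler_pM2l ?mulr_gt0// ler_expR.
  have lt : `|ln t| <= `|ln T| + ln 2.
    have l2 : 0 <= ln 2 :> R by apply: ln_ge0; lra.
    have : ln 2^-1 <= ln t by rewrite ler_ln ?posrE; lra.
    rewrite lnV ?posrE// => h1.
    have h2 : ln t <= ln T by rewrite ler_ln ?posrE; lra.
    have := ler_norm (ln T); have := normr_ge0 (ln T).
    by rewrite ler_norml => h3 h4; apply/andP; split; lra.
  have : r * ln t <= `|r| * `|ln t| by rewrite -normrM ler_norm.
  have := ler_wpM2l (normr_ge0 r) lt.
  move: lt; move: (`|ln T| + ln 2) => Z; lra.
pose C := A + B * (T ^+ 2) / weight r kappa 1 * S + 1.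
have T20 : 1 <= T ^+ 2 by rewrite exprn_ege1.
have BT : 0 <= B * (T ^+ 2) / weight r kappa 1 * S.
  by rewrite !mulr_ge0 ?(ltW B0) ?(ltW S0) ?invr_ge0 ?(ltW w1)//; lra.
have pos t : 2^-1 <= t ->
  [/\ `|lambda t| <= C * weight r kappa t,
      `|t * D1 lambda t| <= C * weight r kappa t &
      `|t ^+ 2 * D2 lambda t| <= C * weight r kappa t].
  move=> t2; have wt := weight_gt0 r kappa t2.
  have [Tt|tT] := ltP T t.
    have [h1 h2 h3] := hA t Tt.
    have : A * weight r kappa t <= C * weight r kappa t.
      by rewrite ler_pM2r// /C; lra.
    by move=> h; split; exact: le_trans h.
  have t2T : 2^-1 <= t <= T by rewrite t2.
  have [h1 h2 h3] := hB t t2T.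
  have BC : B * T ^+ 2 <= C * weight r kappa t.
    have h : B * T ^+ 2 <= B * (T ^+ 2) / weight r kappa 1 * (S * weight r
        kappa t).
      rewrite -mulrA ler_peMr//; first by rewrite mulr_ge0// ltW//; lra.
      by rewrite mulrC ler_pdivlMr// mul1r wS.
    apply: (le_trans h); rewrite mulrA ler_pM2r// /C; lra.
  have t0 : 0 <= t by lra.
  have tT2 : t ^+ 2 <= T ^+ 2 by rewrite ler_sqr ?nnegrE; lra.
  have tT2' : t <= T ^+ 2 by rewrite expr2; nra.
  have BT1 : B <= B * T ^+ 2 by rewrite ler_peMr// ltW.
  split.
  - lra.
  - rewrite normrM (ger0_norm t0) (le_trans _ BC)// mulrC ler_pM//.
  - rewrite normrM (ger0_norm (sqr_ge0 t)) (le_trans _ BC)// mulrC ler_pM//.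
    exact: sqr_ge0.
exists C; first by rewrite /C; lra.
move=> t; have [t0|t0] := leP 0 t; first by rewrite ger0_norm//; exact: pos.
rewrite ltr0_norm// => t2.
have lN : (fun u => lambda (- u)) = lambda by apply/funext => u; rewrite lE.
have d1 u : D1 lambda u = - D1 lambda (- u).
  by have [d _ _] := sl (- u); rewrite /D1 -[in LHS]lN derive1_oppr.
have d2 : D2 lambda t = D2 lambda (- t).
  have dN : derivable (D1 lambda) (- t) 1 by have [_ d _] := sl (- t).
  have := derive1_oppr dN.
  have -> : (fun u => D1 lambda (- u)) = (fun u => - D1 lambda u).
    by apply/funext => u; rewrite d1 opprK.
  have := is_deriveN (smooth2_D2 t sl) => h.
  by rewrite derive1E derive_val => /oppr_inj.
have [h1 h2 h3] := pos (- t) t2.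
split; first by rewrite -lE.
- by rewrite d1 mulrN -mulNr.
- by rewrite d2 -sqrrN.
Qed.

Lemma locally_cst_D f (P : R -> Prop) (c : R) :
  (forall u : R, P u -> \near u, P u) -> (forall u, P u -> f u = c) ->
  forall u, P u -> [/\ f u = c, D1 f u = 0 & D2 f u = 0].
Proof.
move=> nP fc.
have D0 (g : R -> R) (b : R) : (forall u, P u -> g u = b) ->
    forall u, P u -> derive1 g u = 0.
  move=> gb u Pu; rewrite (@derive1_eqfun _ _ (cst b)) ?derive1_cst//.
  by apply: filterS (nP u Pu) => x; exact: gb.
have z1 : forall u, P u -> D1 f u = 0 by exact: (D0 _ c).
by move=> u Pu; split; [exact: fc|exact: z1|exact: D0 z1 _ Pu].
Qed.

(** The derivatives of the cutoff live on 1/2 <= |s| <= 1, where they are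
    bounded by compactness. *)
Lemma cutoff_bounds theta : cutoff theta ->
  exists2 C : R, 1 <= C & forall s : R,
  [/\ `|theta s| <= C, `|s * D1 theta s| <= C, `|s ^+ 2 * D2 theta s| <= C &
    `|s| < 2^-1 -> [/\ theta s = 1, D1 theta s = 0 & D2 theta s = 0] ].
Proof.
move=> [st t1 t0].
have [C C0 hC] := @smooth2_bounded theta (-1) 1 (ltac:(lra)) st.
have out s : 1 < `|s| -> [/\ theta s = 0, D1 theta s = 0 & D2 theta s = 0].
  apply: (@locally_cst_D theta (fun u => 1 < `|u|)) => u u1.
    by exact: (@cvgr_norm_gt R R R (nbhs u) _ id u (@cvg_id _ (nbhs u)) 1 u1).
  by apply: t0; rewrite -ltr_norml -leNgt ltW.
exists (C + 1); first lra.
move=> s; have inside : `|s| < 2^-1 -> [/\ theta s = 1, D1 theta s = 0 &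
    D2 theta s = 0].
  move: s; apply: (@locally_cst_D theta (fun u => `|u| < 2^-1)) => u u1.
    by exact: (@cvgr_norm_lt R R R (nbhs u) _ id u (@cvg_id _ (nbhs u)) 2^-1 u1).
  by apply: t1; rewrite -ler_norml ltW.
have [s1|s1] := ltP 1 `|s|.
  have [-> -> ->] := out s s1; rewrite !mulr0 normr0; split => //; lra.
have [h1 h2 h3] := hC s (ltac:(by rewrite -ler_norml)).
split => //.
- lra.
- by rewrite normrM (@le_trans _ _ (1 * C))//; [rewrite ler_pM|lra].
- rewrite normrM (@le_trans _ _ (1 * C))//; [rewrite ler_pM//|lra].
  by rewrite normrX exprn_ile1.
Qed.

End masks.

(** * The high-pass kernel *)

Lemma sqrD_near (R : realType) (m t d : R) : 1 <= m -> `|d - t| <= 1 ->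
  m ^+ 2 + t ^+ 2 <= 3 * (m ^+ 2 + d ^+ 2).
Proof.
move=> m1; rewrite ler_norml => /andP[d1 d2].
have m2 : 1 <= m ^+ 2 by rewrite exprn_ege1.
have dd : 0 <= (1 - (d - t)) * (1 + (d - t)) by rewrite mulr_ge0; lra.
have := sqr_ge0 (d + (d - t)); rewrite !expr2 in m2 *; nra.
Qed.

Section highpass.
Context {R : realType}.
Variables (theta lambda : R -> R) (r kappa : R).
Local Notation w := (weight r kappa).
Local Notation rho := ((r + 1) / 2).

Definition highpass (m t : R) := (1 - theta (t / m)) * lambda t.

Hypothesis theta_cutoff : cutoff theta.
Hypothesis lambda_mask : decay_mask r kappa lambda.
Hypothesis r_gt1 : 1 < r.

(** Below m / 2 the factor 1 - theta(t / m) vanishes. Above, each derivative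
    gains a factor 1 / |t|: on lambda by the symbol estimates, on the cutoff
    because |t| is comparable to m wherever its derivatives do not vanish. *)
Lemma highpass_bounds : exists2 C : R, 0 < C & forall m t : R, 1 <= m ->
  `|highpass m t| <= C * w m * plateau rho m `|t| /\
  `|2 * highpass m t - highpass m (t - 1) - highpass m (t + 1)| <=
    C * w m / m ^+ 2 * plateau 2 m `|t|.
Proof.
have r1 := r_gt1.
have [A A1 hA] := cutoff_bounds theta_cutoff.
have [B B0 hB] := mask_bounds lambda_mask.
have [P P0 hP] := weight_tail kappa r_gt1.
have sl : smooth2 lambda by case: lambda_mask.
have st : smooth2 theta by case: theta_cutoff.
have AB0 : 0 < A * B by rewrite mulr_gt0//; lra.
have [K K0 KE] : exists2 K : R, 0 < K & K = 5 * (A * B) * P.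
  by exists (5 * (A * B) * P) => //; rewrite mulr_gt0// mulr_gt0.
(* 15 = 5 * 3: where the second derivative does not vanish, m^2 + d^2 is at most
   5 d^2, and sqrD_near moves from d to t. *)
exists (15 * K); first by rewrite mulr_gt0.
move=> m t m1; have m0 : 0 < m by lra.
have mV0 : 0 < m^-1 by rewrite invr_gt0.
have wm : 0 < w m by apply: weight_gt0; lra.
pose q (t : R) := 1 - theta (t / m).
pose q1 (t : R) := - (D1 theta (t / m) / m).
pose q2 (t : R) := - (D2 theta (t / m) / m / m).
pose a1 (t : R) := q1 t * lambda t + q t * D1 lambda t.
pose a2 (t : R) := (q2 t * lambda t + q1 t * D1 lambda t) +
                   (q1 t * D1 lambda t + q t * D2 lambda t).
have dq (u : R) : is_derive u 1 q (q1 u).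
  have := is_derive_scale_arg (smooth2_D1 (u * m^-1) st).
  move=> /(is_deriveB (is_derive_cst (1 : R) u (1 : R))); rewrite sub0r; exact.
have dq1 (u : R) : is_derive u 1 q1 (q2 u).
  have /(is_derive_scale_arg) h1 := smooth2_D2 (u * m^-1) st.
  have := is_deriveM1 h1 (is_derive_cst m^-1 u 1).
  rewrite mulr0 addr0 => /is_deriveN; exact.
have da (u : R) : is_derive u 1 (highpass m) (a1 u).
  exact: (is_deriveM1 (dq u) (smooth2_D1 u sl)).
have da1 (u : R) : is_derive u 1 a1 (a2 u).
  have h1 := is_deriveM1 (dq1 u) (smooth2_D1 u sl).
  have h2 := is_deriveM1 (dq u) (smooth2_D2 u sl).
  exact: (is_deriveD h1 h2).
have near0 (u : R) : `|u| < m / 2 -> q u = 0 /\ a2 u = 0.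
  move=> um; have [_ _ _] := hA (u / m).
  have -> : `|u / m| < 2^-1.
    by rewrite normrM (gtr0_norm mV0) ltr_pdivrMr// mulrC.
  move=> /(_ isT)[e0 e1 e2].
  by rewrite /a2 /q /q1 /q2 e0 e1 e2 subrr !mul0r oppr0 !mul0r !addr0.
have far (u : R) : m / 2 <= `|u| -> [/\ `|q u| <= 2 * A, `|u * q1 u| <= A &
    `|u ^+ 2 * q2 u| <= A].
  move=> um; have [h0 h1 h2 _] := hA (u / m); split.
  - by rewrite (le_trans (ler_normB _ _))// normr1; lra.
  - by rewrite (_ : u * _ = - (u / m * D1 theta (u / m))) ?normrN// /q1; ring.
  - rewrite (_ : u ^+ 2 * _ = - ((u / m) ^+ 2 * D2 theta (u / m))) ?normrN//.
    by rewrite /q2; field; rewrite gt_eqF.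
have wu (u : R) : m / 2 <= `|u| -> w `|u| <= P * w m * plateau rho m `|u|.
  exact: hP.
have pl1 (u : R) : plateau rho m u <= 1 by apply: plateau_le1; lra.
have Bw (u : R) : m / 2 <= `|u| -> 0 <= B * w `|u|.
  by move=> um; rewrite mulr_ge0 ?(ltW B0)// ltW// weight_gt0//; lra.
split.
  have [tm|tm] := ltP `|t| (m / 2).
    rewrite /highpass -/(q t) (near0 t tm).1 mul0r normr0.
    rewrite mulr_ge0 ?plateau_ge0// mulr_ge0 ?(ltW wm)//.
    by rewrite mulr_ge0// ltW.
  have [h0 _ _] := far t tm; have [h1 _ _] := hB t (ltac:(lra)).
  rewrite /highpass -/(q t) normrM (le_trans (ler_pM _ _ h0 h1))//.
  have := wu t tm; set p := plateau _ _ _ => h2.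
  apply: (@le_trans _ _ (2 * A * (B * (P * w m * p)))).
    by rewrite ler_wpM2l ?mulr_ge0 ?ler_pM2l//; lra.
  rewrite (_ : 2 * A * (B * (P * w m * p)) = 2 * (A * B * P * w m * p));
      last by ring.
  rewrite (_ : 15 * K * w m * p = 75 * (A * B * P * w m * p)); last first.
    by rewrite KE; ring.
  rewrite ler_wpM2r//; last by lra.
  rewrite mulr_ge0 ?plateau_ge0// mulr_ge0 ?(ltW wm)//.
  by rewrite mulr_ge0 ?(ltW P0)// ltW.
have a2b (d : R) : `|a2 d| * (m ^+ 2 + d ^+ 2) <= 5 * K * w m.
  have [dm|dm] := ltP `|d| (m / 2).
    rewrite (near0 d dm).2 normr0 mul0r mulr_ge0 ?(ltW wm)//.
    by rewrite mulr_ge0// ltW.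
  have [h0 h1 h2] := far d dm; have [g0 g1 g2] := hB d (ltac:(lra)).
  have Bw0 := Bw d dm; have wd := wu d dm.
  have wd' : B * w `|d| <= B * (P * w m).
    apply: (ler_wpM2l (ltW B0)); apply: (le_trans wd).
    apply: ler_piMr (pl1 _); apply: mulr_ge0; exact: ltW.
  have d2a : d ^+ 2 * `|a2 d| <= K * w m.
    have -> : K * w m = 5 * A * (B * (P * w m)) by rewrite KE; ring.
    apply: (@le_trans _ _ (5 * A * (B * w `|d|))); last first.
      by rewrite ler_wpM2l//; lra.
    rewrite -[d ^+ 2]ger0_norm ?sqr_ge0// -normrM.
    rewrite (_ : d ^+ 2 * a2 d = (d ^+ 2 * q2 d) * lambda d +
      (d * q1 d) * (d * D1 lambda d) + ((d * q1 d) * (d * D1 lambda d) +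
       q d * (d ^+ 2 * D2 lambda d))); last by rewrite /a2; ring.
    have M (x y c : R) : `|x| <= c -> `|y| <= B * w `|d| ->
        `|x * y| <= c * (B * w `|d|).
      by move=> hx hy; rewrite normrM ler_pM.
    have k1 := M _ _ _ h2 g0; have k2 := M _ _ _ h1 g1; have k3 := M _ _ _ h0 g2.
    move: k1 k2 k3; set X := d ^+ 2 * q2 d * lambda d.
    set Y := d * q1 d * (d * D1 lambda d).
    set Z := q d * (d ^+ 2 * D2 lambda d) => k1 k2 k3.
    have := ler_normD (X + Y) (Y + Z); have := ler_normD X Y;
        have := ler_normD Y Z.
    lra.
  have md : m ^+ 2 <= 4 * d ^+ 2.
    rewrite -[d ^+ 2]real_normK ?num_real//.
    have : 0 <= `|d| by []. move: dm; move: `|d| => e; rewrite !expr2; nra.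
  apply: (@le_trans _ _ (`|a2 d| * (5 * d ^+ 2)));
      first by rewrite ler_wpM2l//; lra.
  rewrite mulrCA -(mulrA 5) ler_pM2l//; first by rewrite mulrC.
have [d dt ->] := second_difference_derive t da da1.
rewrite normrN.
have M0 : 0 < Num.max m `|t| by rewrite lt_max m0.
rewrite /plateau powR_mulrn ?divr_ge0 ?(ltW m0) ?(ltW M0)//.
rewrite (_ : _ / m ^+ 2 * _ = 15 * K * w m / (Num.max m `|t|) ^+ 2); last first.
  by field; rewrite !gt_eqF.
rewrite ler_pdivlMr ?exprn_gt0//.
have mx : (Num.max m `|t|) ^+ 2 <= m ^+ 2 + t ^+ 2.
  rewrite -[t ^+ 2]real_normK ?num_real//.
  by rewrite /Num.max; case: ifP => _; rewrite ?lerDl ?lerDr sqr_ge0.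
have td : m ^+ 2 + t ^+ 2 <= 3 * (m ^+ 2 + d ^+ 2).
  exact: sqrD_near.
have := a2b d.
have : `|a2 d| * Num.max m `|t| ^+ 2 <= `|a2 d| * (3 * (m ^+ 2 + d ^+ 2)).
  by rewrite ler_wpM2l// (le_trans mx).
rewrite mulrCA; lra.
Qed.

End highpass.

Section highpass_kernel.
Context {R : realType}.
Variables (theta lambda : R -> R) (r kappa : R).
Local Notation w := (weight r kappa).
Local Notation rho := ((r + 1) / 2).
Local Notation highpass := (highpass theta lambda).

Hypothesis theta_cutoff : cutoff theta.
Hypothesis lambda_mask : decay_mask r kappa lambda.
Hypothesis r_gt1 : 1 < r.

(** From m^2 on the envelope is below 1 / m, so that the end terms of the
    summation by parts are no larger than the main term. *)
Lemma plateau_small (p m t : R) : 1 <= p -> 1 <= m -> m ^+ 2 <= t ->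
  plateau p m t <= m^-1.
Proof.
move=> p1 m1 mt; have m0 : 0 < m by lra.
have mt' : m <= t by apply: le_trans mt; rewrite expr2; nra.
have t0 : 0 < t by lra.
rewrite plateauE// -[leRHS]lnK ?posrE ?invr_gt0// ler_expR lnV ?posrE//.
have lm : 0 <= ln m by exact: ln_ge0.
have : ln (m ^+ 2) <= ln t by rewrite ler_ln ?posrE// exprn_gt0.
rewrite lnXn// => h; nra.
Qed.

(** The absolute sum of the symbol is at most a multiple of m w(m), and that of
    its second differences at most a multiple of w(m) / m; the two bounds combine
    into one that is integrable uniformly in m. *)
Lemma highpass_kernel : exists2 C : R, 0 < C & forall m n : nat, (0 < m)%N ->
  (m ^ 2 <= n)%N -> forall u : R,
  normc (psum (highpass m%:R) n u) * (1 + m%:R ^+ 2 * (2 - 2 * cos u)) <=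
  C * w m%:R * m%:R.
Proof.
have r1 := r_gt1.
have [C C0 hC] := highpass_bounds theta_cutoff lambda_mask r_gt1.
pose S := 2 + (rho - 1)^-1.
have S0 : 0 < S by rewrite ltr_wpDr// invr_ge0; lra.
exists (C * (2 * S + 10)); first by rewrite mulr_gt0//; lra.
move=> m n m0 mn u.
have m1 : 1 <= m%:R :> R by rewrite ler1n.
have m0' : 0 < m%:R :> R by rewrite ltr0n.
have wm : 0 < w m%:R by apply: weight_gt0; lra.
pose a := highpass m%:R.
have nn (k : nat) : `|k%:R| = k%:R :> R by rewrite ger0_norm.
have h1 : normc (psum a n u) <= 2 * \sum_(k < n.+1) (C * w m%:R * plateau rho
    m%:R k%:R).
  apply: (@normc_psum_le _ _ _ _ (fun k =>
      C * w m%:R * plateau rho m%:R k%:R)) => k _.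
    by have := (hC _ k%:R m1).1; rewrite (nn k).
  by have := (hC _ (- k%:R) m1).1; rewrite normrN (nn k).
have h2 : normc (psum (fun t => 2 * a t - a (t - 1) - a (t + 1)) n u) <=
    2 * \sum_(k < n.+1) (C * w m%:R / m%:R ^+ 2 * plateau 2 m%:R k%:R).
  apply: (@normc_psum_le _ _ _ _
    (fun k => C * w m%:R / m%:R ^+ 2 * plateau 2 m%:R k%:R)) => k _.
    by have := (hC _ k%:R m1).2; rewrite (nn k).
  by have := (hC _ (- k%:R) m1).2; rewrite normrN (nn k).
have h3 := normc_psum_second_difference a n u.
have mn2 : m%:R ^+ 2 <= n%:R :> R by rewrite -natrX ler_nat.
have bd (t : R) : n%:R <= `|t| -> `|a t| <= C * w m%:R * m%:R^-1.
  move=> nt; apply: (le_trans (hC _ t m1).1); rewrite (ler_pM2l (mulr_gt0 C0 wm)).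
  by apply: plateau_small; lra.
have b1 : `|a n%:R| <= C * w m%:R * m%:R^-1 by apply: bd; rewrite nn.
have b2 : `|a (- n%:R)| <= C * w m%:R * m%:R^-1 by apply: bd; rewrite normrN nn.
have nn1 : `|n%:R + 1| = n%:R + 1 :> R by rewrite ger0_norm// addr_ge0.
have b3 : `|a (n%:R + 1)| <= C * w m%:R * m%:R^-1.
  by apply: bd; rewrite nn1 lerDl.
have b4 : `|a (- (n%:R + 1))| <= C * w m%:R * m%:R^-1.
  by apply: bd; rewrite normrN nn1 lerDl.
rewrite -mulr_sumr in h1; rewrite -mulr_sumr in h2.
have s1 := plateau_sum n.+1 (ltac:(lra) : 1 < rho) m0.
have s2 := plateau_sum n.+1 (ltac:(lra) : 1 < 2 :> R) m0.
set W := C * w m%:R in h1 h2 b1 b2 b3 b4 *; have W0 : 0 < W by exact: mulr_gt0.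
have k1 : normc (psum a n u) <= 2 * S * W * m%:R.
  apply: (le_trans h1).
  rewrite (_ : 2 * S * W * m%:R = 2 * (W * (S * m%:R))); last by ring.
  by rewrite ler_pM2l// (ler_pM2l W0).
have k2 : normc (psum (fun t => 2 * a t - a (t - 1) - a (t + 1)) n u) <=
    6 * W / m%:R.
  apply: (le_trans h2).
  apply: (@le_trans _ _ (2 * (W / m%:R ^+ 2 * ((2 + (2 - 1)^-1) * m%:R)))).
    by rewrite ler_pM2l// ler_pM2l// divr_gt0// exprn_gt0.
  rewrite (_ : 2 - 1 = 1 :> R) ?invr1; last by ring.
  by rewrite le_eqVlt; apply/orP; left; apply/eqP; field; rewrite gt_eqF.
have k3 : (2 - 2 * cos u) * normc (psum a n u) <= 10 * W / m%:R.
  apply: (le_trans h3); move: b1 b2 b3 b4 k2.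
  rewrite -!(mulrA _ W).
  set Z := W / m%:R; lra.
rewrite mulrDr mulr1 (mulrCA _ (m%:R ^+ 2)) (mulrC (normc _)).
have : m%:R ^+ 2 * ((2 - 2 * cos u) * normc (psum a n u)) <= 10 * W * m%:R.
  rewrite (_ : 10 * W * m%:R = m%:R ^+ 2 * (10 * W / m%:R)); last first.
    by field; rewrite gt_eqF.
  by rewrite ler_pM2l// exprn_gt0.
rewrite (_ : C * (2 * S + 10) * w m%:R * m%:R = 2 * S * W * m%:R + 10 * W * m%:R);
  last by rewrite /W; ring.
lra.
Qed.

End highpass_kernel.

(** * Sampling and the error kernel *)

Section sampling.
Context {R : realType}.
Implicit Types (a b h : R -> R) (x t : R).

Definition node (m k : nat) : R := 2 * pi * k%:R / (2 * m).+1%:R.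

(** By the orthogonality of the sampled characters, averaging over the nodes is
    as good as the exact convolution for frequencies of modulus at most m. *)
Lemma sampled_product h b (m : nat) x t :
  ((2 * m).+1%:R^-1)%:C%C * \sum_(k < (2 * m).+1)
     psum h m (node m k - t) * psum b m (x - node m k) =
  psum (fun u => h u * b u) m (x - t).
Proof.
pose f (i : nat) : R := i%:R - m%:R.
pose c (i l : nat) : R[i] :=
  (h (f i) * b (f l))%:C%C * cexpi (f l * x - f i * t).
have E : \sum_(k < (2 * m).+1) psum h m (node m k - t) * psum b m (x - node m k) =
    \sum_(i < (2 * m).+1) \sum_(l < (2 * m).+1) c i l *
      \sum_(k < (2 * m).+1) cexpi ((i%:R - l%:R) * (2 * pi * k%:R / (2 *
          m).+1%:R)).
  under eq_bigr => k _.
    rewrite /psum big_distrlr /=.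
    under eq_bigr => i _.
      under eq_bigr => l _.
        rewrite mulrACA -rmorphM/= -cexpiD.
        have -> : (i%:R - m%:R) * (node m k - t) + (l%:R - m%:R) * (x - node m
            k) =
            (f l * x - f i * t) + (i%:R - l%:R) * (2 * pi * k%:R / (2 * m).+1%:R).
          by rewrite /f /node; ring.
        rewrite cexpiD mulrA -/(f i) -/(f l) -/(c i l).
        over.
      over.
    over.
  rewrite exchange_big/=; apply: eq_bigr => i _.
  rewrite exchange_big/=; apply: eq_bigr => l _.
  by rewrite mulr_sumr.
rewrite E /psum mulr_sumr; apply: eq_bigr => i _.
rewrite (bigD1 i)//= [X in _ * (_ + X)]big1 ?addr0; last first.
  move=> l li. rewrite sampled_orthogonality// eq_sym.
  by rewrite (inj_eq val_inj) (negbTE li) mulr0.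
rewrite sampled_orthogonality// eqxx mulrC -mulrA.
have -> : ((2 * m).+1%:R : R[i]) * (((2 * m).+1%:R^-1 : R)%:C)%C = 1.
  by rewrite -[X in X * _](rmorph_nat (real_complex R)) -rmorphM/= divff//
      pnatr_eq0.
by rewrite mulr1 /c -/(f i); congr (_ * cexpi _); ring.
Qed.

Lemma psum_tail a (m d : nat) x :
  normc (psum a (m + d) x - psum a m x) <=
  \sum_(k < d) (`|a (m + k).+1%:R| + `|a (- (m + k).+1%:R)|).
Proof.
rewrite !psumE big_split_ord/= addrA [X in normc X]addrC addKr.
rewrite (le_trans (normc_sum _ _ _))//; apply: ler_sum => k _.
rewrite (le_trans (le_normcD _ _))// !ComplexField.Normc.normcM !normc_cexpi.
by rewrite !mulr1 !normc_real.
Qed.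

(** The terms of an average are no larger than their maximum: a crude bound of
    the aliasing terms is enough, since they decay exponentially. *)
Lemma aliasing_le h b (m d : nat) x t (A B : R) :
  (forall y, normc (psum h m y) <= A) ->
  (forall y, normc (psum b (m + d) y - psum b m y) <= B) ->
  normc (((2 * m).+1%:R^-1)%:C%C * \sum_(k < (2 * m).+1)
     psum h m (node m k - t) * psum b (m + d) (x - node m k) -
   psum (fun u => h u * b u) m (x - t)) <= A * B.
Proof.
move=> hA hB; rewrite -sampled_product -mulrBr -sumrB.
rewrite ComplexField.Normc.normcM normc_real ger0_norm ?invr_ge0//.
rewrite mulrC ler_pdivrMr ?ltr0n//.
apply: (le_trans (normc_sum _ _ _)).
apply: (@le_trans _ _ (\sum_(k < (2 * m).+1) A * B)).
  apply: ler_sum => k _; rewrite -mulrBr ComplexField.Normc.normcM.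
  by rewrite ler_pM ?normc_ge0.
by rewrite sumr_const card_ord mulr_natr.
Qed.

End sampling.

Section error_kernel.
Context {R : realType}.
Variables (theta lambda beta : R -> R) (r kappa : R).
Local Notation w := (weight r kappa).

(** The integral kernel of the operator g |-> f - Q f. *)
Definition error_kernel (m : nat) (x t : R) : R[i] :=
  phi lambda (x - t) - ((2 * m).+1%:R^-1)%:C%C * \sum_(k < (2 * m).+1)
    Hm theta lambda beta m (node m k - t) * phi beta (x - node m k).

(** The second term is proportional to a Poisson kernel of bandwidth m, since
    2 - 2 cos u = |1 - exp(iu)|^2; its integral is bounded independently
    of m. *)
Definition poisson_bound (m u : R) : R := 1 + m / (1 + m ^+ 2 * (2 - 2 * cos u)).

Hypothesis theta_cutoff : cutoff theta.
Hypothesis lambda_mask : decay_mask r kappa lambda.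
Hypothesis beta_exp : exponent_type beta.
Hypothesis r_gt1 : 1 < r.

Lemma HmE (m : nat) (y : R) : (0 < m)%N ->
  Hm theta lambda beta m y =
  psum (fun t => theta (t / m%:R) * (lambda t / beta t)) m y.
Proof.
move=> m0; apply: phi_finite => t mt.
have [_ _ t0] := theta_cutoff.
rewrite t0 ?mul0r// -ltr_norml normrM (@ger0_norm _ (m%:R^-1)) ?invr_ge0// -leNgt.
by rewrite ler_pdivlMr ?ltr0n// mul1r ltW.
Qed.

Lemma mask_summable : exists B : R, forall n,
  \sum_(k < n) (`|lambda k.+1%:R| + `|lambda (- k.+1%:R)|) <= B.
Proof.
have r1 := r_gt1.
have [B B0 hB] := mask_bounds lambda_mask.
have [P P0 hP] := weight_tail kappa r_gt1.
pose K := B * (P * w 1).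
have w1 : 0 < w 1 by apply: weight_gt0; lra.
have K0 : 0 <= K.
  by apply: mulr_ge0; first exact: ltW; apply: mulr_ge0; exact: ltW.
exists (2 * K * ((2 + ((r + 1) / 2 - 1)^-1) * 1)) => n.
have hk (k : nat) (t : R) : `|t| = k.+1%:R ->
    `|lambda t| <= K * plateau ((r + 1) / 2) 1 k.+1%:R.
  move=> tk; have k1 : 1 <= k.+1%:R :> R by rewrite ler1n.
  have [|h _ _] := hB t; first by rewrite tk; lra.
  apply: (le_trans h); rewrite tk /K -mulrA; apply: (ler_wpM2l (ltW B0)).
  by apply: hP; lra.
apply: (@le_trans _ _ (\sum_(k < n) 2 * K * plateau ((r + 1) / 2) 1 k.+1%:R)).
  apply: ler_sum => k _; rewrite -mulrA mulr_natl mulr2n.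
  by rewrite lerD// hk// ?normrN ger0_norm.
rewrite -mulr_sumr; apply: ler_wpM2l; first by rewrite mulr_ge0.
have rho1 : 1 < (r + 1) / 2 by lra.
have := @plateau_sum R _ 1 n.+1 rho1 isT.
by rewrite big_ord_recl/=; apply: le_trans; rewrite lerDr plateau_ge0.
Qed.

Lemma mask_cvg (y : R) : ccvg (fun n => psum lambda n y) (phi lambda y).
Proof. by have [B hB] := mask_summable; exact: ccvg_psum hB. Qed.

(** At the frequency 0, where the weight degenerates, lambda is compared with the
    weight at 1 instead. *)
Lemma mask_head (s : R) : 0 < s ->
  exists2 C : R, 0 < C & forall m j : nat, (0 < m)%N -> (j <= m)%N ->
    forall t : R, `|t| = j%:R ->
    `|lambda t| * expR (- s * (m%:R - j%:R)) <=
    C * w m%:R * expR (- (s / 2) * (m%:R - j%:R)).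
Proof.
move=> s0.
have [B B0 hB] := mask_bounds lambda_mask.
have [P P0 hP] := weight_head kappa r_gt1 s0.
have w1 : 0 < w 1 by apply: weight_gt0; lra.
pose B1 := B + `|lambda 0| / w 1.
have B10 : 0 <= `|lambda 0| / w 1 by apply: divr_ge0 => //; exact: ltW.
have B1B : B <= B1 by rewrite lerDl.
exists (B1 * P); first by rewrite mulr_gt0//; lra.
move=> m j m0 jm t tj.
have m1 : 1 <= m%:R :> R by rewrite ler1n.
have wm : 0 < w m%:R by apply: weight_gt0; lra.
have rE (E : R) : B1 * P * w m%:R * E = B1 * (P * w m%:R * E) by ring.
have [j0|j0] := posnP j; last first.
  have j1 : 1 <= j%:R :> R by rewrite ler1n.
  have jm' : j%:R <= m%:R :> R by rewrite ler_nat.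
  have wj : 0 < w j%:R by apply: weight_gt0; lra.
  have [|h _ _] := hB t; first by rewrite tj; lra.
  have hl : `|lambda t| <= B1 * w j%:R.
    by apply: (le_trans h); rewrite tj; apply: (ler_wpM2r (ltW wj)).
  apply: (le_trans (ler_wpM2r (expR_ge0 _) hl)).
  rewrite rE -(mulrA B1); apply: ler_wpM2l; first lra.
  exact: hP.
move: tj; rewrite j0 => /eqP; rewrite normr_eq0 => /eqP ->.
rewrite subr0.
have hl : `|lambda 0| <= B1 * w 1.
  rewrite /B1 mulrDl divfK ?gt_eqF// lerDr.
  by apply: mulr_ge0; exact: ltW.
apply: (le_trans (ler_wpM2r (expR_ge0 _) hl)).
rewrite rE -(mulrA B1); apply: ler_wpM2l; first lra.
have := hP m%:R 1 (lexx _) m1.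
have -> : expR (- s * m%:R) = expR (- s * (m%:R - 1)) * expR (- s).
  by rewrite -expRD; congr expR; ring.
have -> : expR (- (s / 2) * m%:R) =
    expR (- (s / 2) * (m%:R - 1)) * expR (- (s / 2)).
  by rewrite -expRD; congr expR; ring.
have e12 : expR (- s) <= expR (- (s / 2)) by rewrite ler_expR; lra.
move=> h; rewrite (mulrA (w 1)) (mulrA (P * w m%:R)).
apply: ler_pM => //.
by apply: mulr_ge0; [exact: ltW|exact: expR_ge0].
Qed.

(** Both the growth of lambda / beta up to the frequency m and the decay of
    beta beyond it are measured against the value beta(m), which cancels. *)
Lemma aliasing_bounds : exists2 C : R, 0 < C & forall m : nat, (0 < m)%N ->
  exists2 b : R, 0 < b &
   (forall y, normc (psum (fun t => theta (t / m%:R) * (lambda t / beta t)) m y)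
      <= C * w m%:R / b) /\
   (forall d y, normc (psum beta (m + d) y - psum beta m y) <= C * b).
Proof.
have [_ [s [s0 [F [F0 Fd bE]]]]] := beta_exp.
have b0 t : 0 < beta t by rewrite bE mulr_gt0 ?expR_gt0 ?F0.
have [A A1 hA] := cutoff_bounds theta_cutoff.
have [L L0 hL] := mask_head s0.
have q0 : 0 < (1 - expR (- s))^-1 by rewrite invr_gt0 subr_gt0 expR_lt1; lra.
have q20 : 0 < (1 - expR (- (s / 2)))^-1.
  by rewrite invr_gt0 subr_gt0 expR_lt1; lra.
pose C1 := 2 * (A * L * (1 - expR (- (s / 2)))^-1).
pose C2 := 2 * (1 - expR (- s))^-1.
have C10 : 0 < C1 by rewrite mulr_gt0// mulr_gt0// mulr_gt0//; lra.
have C20 : 0 < C2 by rewrite mulr_gt0.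
exists (C1 + C2); first by rewrite addr_gt0.
move=> m m0; exists (beta m%:R) => //.
have bm0 := b0 m%:R.
have m1 : 1 <= m%:R :> R by rewrite ler1n.
have wm : 0 < w m%:R by apply: weight_gt0; lra.
have bcmp (u v : R) : 0 <= u -> u <= v ->
    beta v <= beta u * expR (- s * (v - u)).
  move=> u0 uv; have v0 : 0 <= v by lra.
  rewrite !bE !ger0_norm// mulrAC -expRD.
  have -> : - s * u + - s * (v - u) = - s * v by ring.
  by rewrite ler_pM2l ?expR_gt0// Fd.
split.
  move=> y.
  pose e (j : nat) := A * L * w m%:R / beta m%:R * expR (- (s / 2) * (m%:R -
      j%:R)).
  have hj (j : nat) (t : R) : (j <= m)%N -> `|t| = j%:R ->
      `|theta (t / m%:R) * (lambda t / beta t)| <= e j.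
    move=> jm tj; have jm' : j%:R <= m%:R :> R by rewrite ler_nat.
    have bt : beta t = beta j%:R by rewrite !bE tj ger0_norm.
    have [h0 _ _ _] := hA (t / m%:R).
    have h1 := hL m j m0 jm t tj.
    have h2 := bcmp j%:R m%:R (ler0n _ _) jm'.
    rewrite !normrM normfV (gtr0_norm (b0 t)) bt /e.
    have bj := b0 j%:R.
    have h3 : (beta j%:R)^-1 <= expR (- s * (m%:R - j%:R)) / beta m%:R.
      by rewrite ler_pdivlMr// mulrC ler_pdivrMr// mulrC.
    apply: (@le_trans _ _ (A * (`|lambda t| *
        (expR (- s * (m%:R - j%:R)) / beta m%:R)))).
      apply: ler_pM => //; first by rewrite mulr_ge0// invr_ge0 ltW.
      by rewrite ler_wpM2l.
    rewrite [leRHS](_ : _ = A * (L * w m%:R *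
      expR (- (s / 2) * (m%:R - j%:R)) / beta m%:R)); last by ring.
    apply: ler_wpM2l; first lra.
    by rewrite mulrA; apply: ler_wpM2r; rewrite ?invr_ge0 ?(ltW bm0).
  have := @normc_psum_le _ (fun t => theta (t / m%:R) * (lambda t / beta t)) m
      y e.
  move=> h; apply: le_trans (h _ _) _ => [k km|k km|].
  - by apply: hj; rewrite // ger0_norm.
  - by apply: hj; rewrite // normrN ger0_norm.
  rewrite /e -mulr_sumr.
  have sE : \sum_(j < m.+1) expR (- (s / 2) * (m%:R - j%:R)) <=
      (1 - expR (- (s / 2)))^-1.
    rewrite (reindex_inj rev_ord_inj)/=.
    under eq_bigr => j _.
      rewrite subSS natrB; last by rewrite -ltnS ltn_ord.
      rewrite opprB addrCA subrr addr0; over.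
    by apply: expR_sum; lra.
  have AL0 : 0 <= A * L * w m%:R / beta m%:R.
    apply: mulr_ge0; last by rewrite invr_ge0 ltW.
    by apply: mulr_ge0; [rewrite mulr_ge0 ?(ltW L0)//; lra|exact: ltW].
  apply: (le_trans (ler_wpM2l (ler0n _ 2) (ler_wpM2l AL0 sE))).
  rewrite (_ : 2 * _ = C1 * (w m%:R / beta m%:R)); last by rewrite /C1; ring.
  rewrite -mulrA; apply: ler_wpM2r; last lra.
  by apply: divr_ge0; exact: ltW.
move=> d y; apply: (le_trans (psum_tail _ _ _ _)).
apply: (@le_trans _ _ (\sum_(k < d) 2 * beta m%:R * expR (- s * k%:R))).
  apply: ler_sum => k _.
  have bN t : beta (- t) = beta t by rewrite !bE normrN.
  rewrite bN (gtr0_norm (b0 _)) -mulrA mulr_natl mulr2n.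
  have h : beta (m + k).+1%:R <= beta m%:R * expR (- s * k%:R).
    have le1 : m%:R <= (m + k).+1%:R :> R by rewrite ler_nat leqW// leq_addr.
    apply: (le_trans (bcmp _ _ (ler0n _ _) le1)).
    rewrite ler_pM2l// ler_expR !mulNr lerN2 ler_pM2l// lerBrDl -natrD ler_nat.
    exact: leqnSn.
  by rewrite lerD.
rewrite -mulr_sumr.
have := expR_sum d s0; set Z := \sum_(k < d) _ => hZ.
apply: (@le_trans _ _ (C2 * beta m%:R)).
  rewrite (_ : C2 * beta m%:R = 2 * beta m%:R * (1 - expR (- s))^-1).
    by rewrite ler_pM2l// mulr_gt0.
  by rewrite /C2; ring.
by rewrite ler_pM2r//; lra.
Qed.

Lemma beta_cvg (y : R) : ccvg (fun n => psum beta n y) (phi beta y).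
Proof.
have [_ [s [s0 [F [F0 Fd bE]]]]] := beta_exp.
apply: (@ccvg_psum _ _ (2 * F 0 * (1 - expR (- s))^-1)) => n.
have hk (k : nat) (t : R) : `|t| = k.+1%:R ->
    `|beta t| <= F 0 * expR (- s * k%:R).
  move=> tk; have k0 : 0 <= k.+1%:R :> R by [].
  rewrite bE tk normrM !ger0_norm ?expR_ge0 ?(ltW (F0 _ _))// mulrC.
  apply: ler_pM; [exact: ltW (F0 _ k0)|exact: expR_ge0|exact: Fd|].
  by rewrite ler_expR !mulNr lerN2 ler_pM2l// ler_nat.
apply: (@le_trans _ _ (\sum_(k < n) 2 * F 0 * expR (- s * k%:R))).
  apply: ler_sum => k _; rewrite -mulrA mulr_natl mulr2n.
  by rewrite lerD// hk// ?normrN ger0_norm.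
have F00 : 0 <= 2 * F 0 by rewrite mulr_ge0// ltW// F0.
rewrite -mulr_sumr; apply: (ler_wpM2l F00); exact: expR_sum.
Qed.

Lemma poisson_bound_ge1 (m u : R) : 0 <= m -> 1 <= poisson_bound m u.
Proof.
by move=> m0; rewrite lerDl divr_ge0// addr_ge0// mulr_ge0 ?sqr_ge0.
Qed.

(** The frequencies up to m of Q f cancel the low-pass part of f exactly, by
    sampled_product, because (lambda / beta) * beta = lambda; what is left is
    the high-pass kernel and the aliasing terms. *)
Lemma error_kernel_bound : exists2 C : R, 0 < C & forall m : nat, (0 < m)%N ->
  forall x t, normc (error_kernel m x t) <=
    C * w m%:R * poisson_bound m%:R (x - t).
Proof.
have [C C0 hC] := highpass_kernel theta_cutoff lambda_mask r_gt1.
have [D D0 hD] := aliasing_bounds.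
exists (2 * (C + D * D)); first by rewrite mulr_gt0// addr_gt0// mulr_gt0.
move=> m m0 x t; have [b b0 [hb1 hb2]] := hD m m0.
have m1 : 1 <= m%:R :> R by rewrite ler1n.
have wm : 0 < w m%:R by apply: weight_gt0; lra.
pose h (t : R) := theta (t / m%:R) * (lambda t / beta t).
pose En n : R[i] := psum lambda n (x - t) - ((2 * m).+1%:R^-1)%:C%C *
  \sum_(k < (2 * m).+1) psum h m (node m k - t) * psum beta n (x - node m k).
have cE : ccvg En (error_kernel m x t).
  apply: ccvgB; first exact: mask_cvg.
  apply: ccvgMl; apply: ccvg_sum => k; rewrite HmE//.
  by apply: ccvgMl; exact: beta_cvg.
rewrite -(mulrA 2) -(mulrA 2).
apply: (@normc_ccvg_le _ _ _ _ (m ^ 2) cE) => n mn.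
have mn' : (m <= n)%N by rewrite (leq_trans _ mn)// leq_pmulr// mul1n.
have [_ [s [s0 [F [F0 _ bE]]]]] := beta_exp.
have bn0 u : beta u != 0 by rewrite gt_eqF// bE mulr_gt0 ?expR_gt0 ?F0.
have -> : En n = psum (highpass theta lambda m%:R) n (x - t) -
    (((2 * m).+1%:R^-1)%:C%C * \sum_(k < (2 * m).+1)
      psum h m (node m k - t) * psum beta n (x - node m k) -
     psum (fun u => h u * beta u) m (x - t)).
  rewrite /En (@psum_ext _ (highpass theta lambda m%:R)
    (fun u => lambda u - h u * beta u)); last first.
    by move=> u; rewrite /highpass /h; field.
  rewrite psumB (@psum_stable _ (fun u => h u * beta u) m n _ mn'); last first.
    move=> u mu; have [_ _ t0] := theta_cutoff.
    rewrite /h t0 ?mul0r// -ltr_norml normrM (@ger0_norm _ (m%:R^-1))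
        ?invr_ge0// -leNgt.
    by rewrite ler_pdivlMr ?ltr0n// mul1r ltW.
  by rewrite opprB addrA subrK.
have := hC m n m0 mn (x - t).
set Z := 1 + _ * _ => hZ.
have Z0 : 0 < Z.
  have c2 : 0 <= 2 - 2 * cos (x - t) by have := cos_le1 (x - t); lra.
  by have := mulr_ge0 (sqr_ge0 m%:R) c2; rewrite /Z; lra.
have h1 : normc (psum (highpass theta lambda m%:R) n (x - t)) <=
    C * w m%:R * (m%:R / Z) by rewrite mulrA ler_pdivlMr.
have h2 := @aliasing_le _ h beta m (n - m) x t _ _ hb1 (hb2 _).
rewrite subnKC// in h2.
have hDD : D * w m%:R / b * (D * b) = D * D * w m%:R by field; rewrite gt_eqF.
rewrite hDD in h2.
rewrite -(normcN (_ - psum _ m _)) in h2.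
apply: (le_trans (le_normcD _ _)); apply: (le_trans (lerD h1 h2)).
rewrite /poisson_bound -/Z.
have : 0 <= m%:R / Z by rewrite divr_ge0// ltW.
move: (m%:R / Z) => q q0.
have CW : 0 <= C * w m%:R by apply: mulr_ge0; exact: ltW.
have DW : 0 <= D * D * w m%:R.
  by apply: mulr_ge0; [exact: mulr_ge0 (ltW D0) (ltW D0)|exact: ltW].
have DWq := mulr_ge0 DW q0.
rewrite [leRHS](_ : _ = C * w m%:R + D * D * w m%:R + C * w m%:R * q +
  D * D * w m%:R * q); last by ring.
lra.
Qed.

End error_kernel.

(** * Integrals over the torus *)

Section torus_integral.
Context {R : realType}.
Local Notation mu := (@torus_measure R).
Local Notation leb := (@lebesgue_measure R).

Lemma torus_integralE (f : R -> \bar R) :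
  measurable_fun setT f -> (forall x, 0 <= f x)%E ->
  (\int[mu]_x f x =
   ((2 * pi)^-1)%:E * \int[leb]_(x in `[0%R, (2 * pi)%R]%classic) f x)%E.
Proof.
move=> mf f0.
have mI : measurable (`[0%R, (2 * pi)%R]%classic : set (measurableTypeR R)).
  exact: measurable_itv.
rewrite /torus_measure ge0_integral_mscale//; congr (_ * _)%E.
rewrite -(setUv `[0%R, (2 * pi)%R]%classic) ge0_integral_setU//=; last 3 first.
- exact: measurableC.
- exact: measurable_funTS.
- by apply/disj_setPS => x [].
rewrite [X in (_ + X)%E](_ : _ = 0%E) ?adde0.
  apply: eq_measure_integral => A mA AI.
  by rewrite /= /mrestr setIidl.
rewrite (@eq_measure_integral _ _ _ _ mzero) ?integral_measure_zero// => A mA AI.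
rewrite /= /mrestr [X in lebesgue_measure X](_ : _ = set0) ?measure0//.
by apply/seteqP; split => x // [/AI].
Qed.

Lemma torus_measureT : mu setT = 1%E.
Proof.
have p0 : 0 < pi :> R by exact: pi_gt0.
rewrite /torus_measure/= /mscale/= /mrestr setTI.
rewrite lebesgue_measure_itv/= lte_fin mulr_gt0//.
by rewrite -EFinB -EFinM subr0 mulVf// gt_eqF// mulr_gt0.
Qed.

End torus_integral.

Section poisson_integral.
Context {R : realType}.

(** Either the derivative cos is at least 1/2 on all of [0, v], or cos v < 1/2
    and then sin v itself is at least 1/2, while v < 2. *)
Lemma sin_ge_linear (v : R) : 0 <= v <= pi / 2 -> v / 4 <= sin v.
Proof.
move=> /andP[v0 v1]; have := @pihalf_lt2 R => p2; have := @pi_gt0 R => p0.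
have [c /andP[c0 cv] E] : exists2 c : R, 0 <= c <= v & sin v = cos c * v.
  have [|c] := @MVT_segment R sin cos 0 v v0 (fun x _ => is_derive_sin x).
    apply: continuous_subspaceT => x; exact: continuous_sin.
  by rewrite in_itv/= sin0 !subr0 => cv h; exists c.
have cosv0 : 0 <= cos v by apply: cos_ge0_pihalf; apply/andP; split; lra.
have cosc : cos v <= cos c.
  by rewrite leNgt ltr_cos -?leNgt// in_itv/=; apply/andP; split; lra.
have [h|h] := leP 2^-1 (cos v).
  rewrite E; have : 0 <= (cos c - 2^-1) * v by rewrite mulr_ge0//; lra.
  lra.
have s0 : 0 <= sin v by apply: sin_ge0_pi; apply/andP; split; lra.
have := sin2cos2 v; rewrite !expr2.
move: s0 cosv0 h; move: (sin v) (cos v) => s c1 s0 c10 c12 sE.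
have : 2^-1 <= s by nra.
lra.
Qed.

Lemma cos_quadratic (u : R) : `|u| <= pi -> u ^+ 2 / 16 <= 2 - 2 * cos u.
Proof.
move=> up; rewrite -cos_norm -[u ^+ 2]real_normK ?num_real//.
move: up (normr_ge0 u); move: `|u| => {}u up u0.
have h : u / 2 / 4 <= sin (u / 2).
  by apply: sin_ge_linear; apply/andP; split; lra.
have -> : cos u = 1 - 2 * sin (u / 2) ^+ 2.
  rewrite [u in LHS](_ : u = (u / 2) *+ 2); last by rewrite -mulr_natr divfK.
  by rewrite cos_mulr2n sin2cos2 -mulr_natl; ring.
have : (u / 2 / 4) ^+ 2 <= sin (u / 2) ^+ 2.
  by rewrite ler_sqr// nnegrE; lra.
rewrite !expr2; lra.
Qed.

Lemma representative_angle (x : R) : exists2 y : R, 0 <= y <= 2 * pi &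
  cos y = cos x /\ sin y = sin x.
Proof.
have p0 := @pi_gt0 R.
have cx : -1 <= cos x <= 1 by rewrite cos_geN1 cos_le1.
have cE : cos (acos (cos x)) = cos x by rewrite acosK// in_itv/=.
have a0 := acos_ge0 cx; have ap := acos_lepi cx.
have sE : sin (acos (cos x)) = `|sin x|.
  by rewrite sin_acos// -sin2cos2 sqrtr_sqr.
have [s0|s0] := leP 0 (sin x).
  exists (acos (cos x)); first by apply/andP; split; lra.
  by rewrite sE ger0_norm.
exists (2 * pi - acos (cos x)); first by apply/andP; split; lra.
have pE : 2 * pi = pi *+ 2 :> R by rewrite mulr_natl.
rewrite cosB sinB pE cos2pi sin2pi !mul0r !mul1r sub0r addr0 cE sE.
by rewrite ltr0_norm// opprK.
Qed.

(** A Lorentzian of height m and width 4/m; its primitive is an arctangent, so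
    its integral over any interval is at most 4 pi. *)
Definition lorentz (m v : R) : R := m / (1 + (m * v / 4) ^+ 2).

Lemma lorentz_ge0 (m v : R) : 0 <= m -> 0 <= lorentz m v.
Proof. by move=> m0; rewrite divr_ge0// addr_ge0// sqr_ge0. Qed.

Lemma is_derive_lorentz (m y t : R) :
  is_derive t 1 (fun t => - 4 * atan (m * (y - t) / 4)) (lorentz m (y - t)).
Proof.
have h1 : is_derive t 1 (fun t : R => m * (y - t) / 4) (- m / 4).
  have h := is_deriveB (is_derive_cst y t 1) (is_derive_id t 1).
  have h2 := is_deriveM1 (is_deriveM1 (is_derive_cst m t 1) h)
    (is_derive_cst (4^-1 : R) t 1).
  apply: (is_derive_eq h2).
  by rewrite /=; ring.
have h3 := @is_derive1_comp _ (@atan R) _ t _ _ (is_derive1_atan _) h1.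
have h4 := is_deriveM1 (is_derive_cst (- 4 : R) t 1) h3.
apply: (is_derive_eq h4); rewrite /lorentz /=.
move: ((1 + (m * (y - t) / 4) ^+ 2)^-1) => z; by field.
Qed.

(** Seen from a point y of the circle, each point of the circle is within
    distance pi of y, of y - 2 pi or of y + 2 pi. *)
Lemma poisson_le_lorentz (m y t : R) : 0 <= m -> 0 <= y <= 2 * pi ->
  0 <= t <= 2 * pi -> poisson_bound m (y - t) <=
  1 + (lorentz m (y - t) + lorentz m (y - 2 * pi - t) + lorentz m (y + 2 * pi -
      t)).
Proof.
move=> m0 /andP[y0 y1] /andP[t0 t1].
have l (v : R) : 0 <= lorentz m v by exact: lorentz_ge0.
have key (v : R) : `|v| <= pi -> cos v = cos (y - t) ->
    poisson_bound m (y - t) <= 1 + lorentz m v.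
  move=> vp cv; rewrite /poisson_bound lerD2l /lorentz ler_wpM2l//.
  have h := cos_quadratic vp; rewrite cv in h.
  rewrite lef_pV2 ?posrE; last 2 first.
  - rewrite ltr_pwDl// mulr_ge0 ?sqr_ge0//.
  - by rewrite ltr_pwDl// sqr_ge0.
  rewrite lerD2l (_ : (m * v / 4) ^+ 2 = m ^+ 2 * (v ^+ 2 / 16)); last by field.
  by rewrite ler_wpM2l// sqr_ge0.
have pE : 2 * pi = pi *+ 2 :> R by rewrite mulr_natl.
have l1 := l (y - t); have l2 := l (y - 2 * pi - t);
    have l3 := l (y + 2 * pi - t).
have [h1|h1] := leP (y - t) (- pi).
  have : poisson_bound m (y - t) <= 1 + lorentz m (y + 2 * pi - t).
    apply: key; first by rewrite ler_norml; apply/andP; split; lra.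
    by rewrite addrAC pE cosD2pi.
  lra.
have [h2|h2] := leP (y - t) pi.
  have : poisson_bound m (y - t) <= 1 + lorentz m (y - t).
    by apply: key => //; rewrite ler_norml; apply/andP; split; lra.
  lra.
have : poisson_bound m (y - t) <= 1 + lorentz m (y - 2 * pi - t).
  apply: key; first by rewrite ler_norml; apply/andP; split; lra.
  by have := cosD2pi (y - t - pi *+ 2); rewrite subrK => ->; rewrite pE addrAC.
lra.
Qed.

Lemma poisson_boundN (m u : R) : poisson_bound m (- u) = poisson_bound m u.
Proof. by rewrite /poisson_bound cosN. Qed.

Lemma continuous_poisson (m : R) : 0 <= m -> continuous (poisson_bound m).
Proof.
move=> m0 u; apply: cvgD; first exact: cvg_cst.
apply: cvgMr; apply: cvgV.
  rewrite gt_eqF// ltr_pwDl// mulr_ge0 ?sqr_ge0//.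
apply: cvgD; first exact: cvg_cst.
apply: cvgMr; apply: cvgB; first exact: cvg_cst.
by apply: cvgMr; exact: continuous_cos.
Qed.

Lemma poisson_integral (m x : R) : 0 < m ->
  (\int[@torus_measure R]_t (poisson_bound m (x - t))%:E <= 7%:E)%E.
Proof.
move=> m0; have p0 := @pi_gt0 R; have m0' := ltW m0.
have [y y2 [cy sy]] := representative_angle x.
have yE t : poisson_bound m (x - t) = poisson_bound m (y - t).
  by rewrite /poisson_bound !cosB cy sy.
under eq_integral do rewrite yE.
have mP : measurable_fun setT (fun t : R => (poisson_bound m (y - t))%:E).
  apply/measurable_EFinP; apply: continuous_measurable_fun => t.
  apply: (@continuous_comp _ _ _ (fun t => y - t) (poisson_bound m)).
    by apply: cvgB; [exact: cvg_cst|exact: cvg_id].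
  exact: continuous_poisson.
have P0 t : 0 <= poisson_bound m (y - t).
  by rewrite (le_trans ler01)// poisson_bound_ge1.
rewrite torus_integralE//.
pose G (t : R) := 1 + (lorentz m (y - t) + lorentz m (y - 2 * pi - t) +
  lorentz m (y + 2 * pi - t)).
pose A (z t : R) := - 4 * atan (m * (z - t) / 4).
pose F (t : R) := t + (A y t + A (y - 2 * pi) t + A (y + 2 * pi) t).
have dF (t : R) : is_derive t 1 F (G t).
  apply: is_deriveD; apply: is_deriveD; last exact: is_derive_lorentz.
  by apply: is_deriveD; exact: is_derive_lorentz.
have cl (z : R) : continuous (fun t => lorentz m (z - t)).
  move=> t; apply: cvgMr; apply: cvgV.
    by rewrite gt_eqF// ltr_pwDl// sqr_ge0.
  apply: cvgD; first exact: cvg_cst.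
  have h : (fun t : R => m * (z - t) / 4) u @[u --> t] --> m * (z - t) / 4.
    apply: cvgMl; apply: cvgMr.
    by apply: cvgB; [exact: cvg_cst|exact: cvg_id].
  by rewrite expr2; under eq_fun do rewrite expr2; exact: cvgM.
have cG : continuous G.
  move=> t; apply: cvgD; first exact: cvg_cst.
  by apply: cvgD; [apply: cvgD|]; exact: cl.
have cF : continuous F.
  move=> t; apply: differentiable_continuous; apply/derivable1_diffP.
  by case: (dF t).
have FTC : (\int[@lebesgue_measure R]_(t in `[0%R, (2 * pi)%R]) (G t)%:E =
    (F (2 * pi))%:E - (F 0)%:E)%E.
  apply: continuous_FTC2; first by rewrite mulr_gt0.
  - exact: continuous_subspaceT.
  - split.
    + by move=> t _; case: (dF t).
    + by apply: cvg_at_right_filter; exact: cF.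
    + by apply: cvg_at_left_filter; exact: cF.
  - by move=> t _; rewrite derive1E; case: (dF t).
have le1 : (\int[@lebesgue_measure R]_(t in `[0%R, (2 * pi)%R])
    (poisson_bound m (y - t))%:E <=
   \int[@lebesgue_measure R]_(t in `[0%R, (2 * pi)%R]) (G t)%:E)%E.
  apply: ge0_le_integral => //=.
  - by move=> t _; rewrite lee_fin.
  - exact: measurable_funTS.
  - apply: measurable_funTS; apply/measurable_EFinP.
    exact: continuous_measurable_fun.
  - move=> t; rewrite in_itv/= => t2; rewrite lee_fin.
    exact: poisson_le_lorentz.
have i0 : (0 <= ((2 * pi)^-1)%:E :> \bar R)%E.
  by rewrite lee_fin invr_ge0 mulr_ge0// ltW.
apply: (le_trans (lee_wpmul2l i0 le1)).
rewrite FTC -EFinB -EFinM lee_fin.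
rewrite mulrC ler_pdivrMr ?mulr_gt0//.
have AB (z : R) : A z (2 * pi) - A z 0 <= 4 * pi.
  rewrite /A; have := atan_gtNpi2 (m * (z - 2 * pi) / 4).
  by have := atan_ltpi2 (m * (z - 0) / 4); lra.
have := AB y; have := AB (y - 2 * pi); have := AB (y + 2 * pi).
rewrite /F; lra.
Qed.

End poisson_integral.

(** * Schur's test *)

Section schur.
Context d (T : measurableType d) (R : realType).
Variable mu : {sigma_finite_measure set T -> \bar R}.
Local Open Scope ereal_scope.

Import HBNNSimple.

(** Integrals of nonnegative functions are suprema over simple functions, hence
    monotone, measurable or not. *)
Lemma ge0_integral_mono (f g : T -> \bar R) : (forall x, 0 <= f x) ->
  (forall x, f x <= g x) -> \int[mu]_x f x <= \int[mu]_x g x.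
Proof.
move=> f0 fg; have g0 x : 0 <= g x by exact: le_trans (fg x).
rewrite (ge0_integralTE _ f0) (ge0_integralTE _ g0).
apply: ereal_sup_le => _ [h hf <-].
by exists h => // x; exact: le_trans (fg x).
Qed.

Lemma integral_scale (c : R) (f : T -> R) : (0 <= c)%R ->
  measurable_fun setT f -> (forall t, (0 <= f t)%R) ->
  c%:E * \int[mu]_t (f t)%:E = \int[mu]_t (c * f t)%:E.
Proof.
move=> c0 mf f0; under [RHS]eq_integral do rewrite EFinM.
rewrite ge0_integralZl//; first exact/measurable_EFinP.
by move=> t _; rewrite lee_fin.
Qed.

Lemma integral_add (f g : T -> R) :
  measurable_fun setT f -> (forall t, (0 <= f t)%R) ->
  measurable_fun setT g -> (forall t, (0 <= g t)%R) ->
  \int[mu]_t (f t)%:E + \int[mu]_t (g t)%:E = \int[mu]_t (f t + g t)%:E.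
Proof.
move=> mf f0 mg g0; under [RHS]eq_integral do rewrite EFinD.
rewrite ge0_integralD//.
- by move=> t _; rewrite lee_fin.
- exact/measurable_EFinP.
- by move=> t _; rewrite lee_fin.
- exact/measurable_EFinP.
Qed.

Variables (k : T * T -> R) (K : R).
Hypothesis mk : measurable_fun setT k.
Hypothesis k0 : forall z, (0 <= k z)%R.
Hypothesis ksym : forall x t, k (x, t) = k (t, x).
Hypothesis K0 : (0 < K)%R.
Hypothesis kK : forall x, \int[mu]_t (k (x, t))%:E <= K%:E.

Let mkx x : measurable_fun setT (fun t => k (x, t)).
Proof. by apply: measurableT_comp mk _; exact: measurable_pair1. Qed.

Lemma conjugate_exponent (p : R) : (1 < p)%R ->
  exists q : R, [/\ (0 < q)%R, (p^-1 + q^-1 = 1)%R & ((p - 1) * q = p)%R].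
Proof.
move=> p1; have p0 : (0 < p)%R by lra.
have p10 : (p - 1 != 0)%R by rewrite gt_eqF//; lra.
exists (p / (p - 1))%R; split.
- by rewrite divr_gt0//; lra.
- by field; rewrite p10 gt_eqF.
- by field.
Qed.

(** Jensen's inequality for the measure k(x, t) dmu(t) of mass at most K,
   by integrating Young's inequality a^(p-1) y <= y^p / p + a^p / q, which is an
   equality at y = a; the choice a = h / K is the mean. *)
Lemma schur_jensen (p : R) (g : T -> R) (x : T) (h : R) : (1 <= p)%R ->
  measurable_fun setT g -> (forall t, (0 <= g t)%R) -> (0 <= h)%R ->
  h%:E <= \int[mu]_t (k (x, t) * g t)%:E ->
  (h `^ p)%:E <= (K `^ (p - 1))%:E * \int[mu]_t (k (x, t) * g t `^ p)%:E.
Proof.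
move=> p1 mg g0 h0 hI.
have mkg (f : T -> R) : measurable_fun setT f ->
    measurable_fun setT (fun t => (k (x, t) * f t)%:E).
  by move=> mf; apply/measurable_EFinP; exact: measurable_funM.
have mgp : measurable_fun setT (fun t => g t `^ p)%R.
  exact: (measurableT_comp (measurable_powR p) mg).
move: p1; rewrite le_eqVlt => /predU1P[<-|p1].
  rewrite subrr powRr0 mul1e powRr1//.
  by under eq_integral do rewrite powRr1//.
have [q [q0 pq pq1]] := conjugate_exponent p1.
have p0 : (0 < p)%R by lra.
have [->|hn0] := eqVneq h 0%R.
  rewrite powR0 ?gt_eqF// mule_ge0// ?lee_fin ?powR_ge0// integral_ge0// => t _.
  by rewrite lee_fin mulr_ge0// powR_ge0.
have hp : (0 < h)%R by rewrite lt_def hn0.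
pose a := (h / K)%R; have a0 : (0 < a)%R by rewrite divr_gt0.
set J := \int[mu]_t (k (x, t) * g t `^ p)%:E.
have J0 : 0 <= J.
  by apply: integral_ge0 => t _; rewrite lee_fin mulr_ge0// powR_ge0.
have young : (a `^ (p - 1) * h)%:E <= (p^-1)%:E * J + (a `^ p / q)%:E * K%:E.
  rewrite EFinM; apply: (@le_trans _ _ ((a `^ (p - 1))%:E *
      \int[mu]_t (k (x, t) * g t)%:E)).
    by rewrite lee_wpmul2l// lee_fin powR_ge0.
  apply: (@le_trans _ _ ((p^-1)%:E * J +
      (a `^ p / q)%:E * \int[mu]_t (k (x, t))%:E)); last first.
    rewrite leeD2l// lee_wpmul2l// lee_fin divr_ge0// ?powR_ge0//.
    exact: ltW.
  have kg0 t : (0 <= k (x, t) * g t)%R by rewrite mulr_ge0.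
  have kgp0 t : (0 <= k (x, t) * g t `^ p)%R by rewrite mulr_ge0// powR_ge0.
  have aq0 : (0 <= a `^ p / q)%R by rewrite divr_ge0 ?powR_ge0// ltW.
  have pV0 : (0 <= p^-1)%R by rewrite invr_ge0 ltW.
  have mkgr (f : T -> R) : measurable_fun setT f ->
      measurable_fun setT (fun t => k (x, t) * f t)%R.
    by move=> mf; exact: measurable_funM.
  rewrite !integral_scale ?powR_ge0 ?integral_add//; try exact: mkgr;
      last 4 first.
  - by apply: measurable_funM => //; exact: mkgr.
  - by move=> t; rewrite mulr_ge0.
  - exact: measurable_funM.
  - by move=> t; rewrite mulr_ge0.
  apply: ge0_integral_mono => t; first by rewrite lee_fin mulr_ge0// powR_ge0.
  rewrite lee_fin.
  have := @conjugate_powR R (g t) (a `^ (p - 1))%R p q (g0 t) (powR_ge0 _ _) p0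
      q0 pq.
  rewrite -powRrM pq1.
  move=> /(ler_wpM2l (k0 (x, t))).
  by move: (k _) (g t) (g t `^ p)%R (a `^ (p - 1))%R (a `^ p)%R => *; lra.
have Kp : (K * K `^ (p - 1) = K `^ p)%R by rewrite mulr_powRB1// ltW.
have ap : (a `^ (p - 1) * h = a `^ p * K)%R.
  by rewrite -(mulr_powRB1 (ltW a0) p0) [in LHS](_ : h = a * K)%R;
    [ring|rewrite /a divfK// gt_eqF].
have hE : (h `^ p = a `^ p * K `^ p)%R.
  by rewrite -powRM ?(ltW a0) ?(ltW K0)// /a divfK// gt_eqF.
have [Jy|Jfin] := eqVneq J +oo.
  by rewrite Jy gt0_muley ?leey// lte_fin powR_gt0.
have /fineK JE : J \is a fin_num by rewrite ge0_fin_numE// ltey.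
move: young; rewrite -JE -!EFinM -EFinD !lee_fin ap hE -Kp.
have -> : (q^-1 = 1 - p^-1)%R by lra.
move=> young.
have h1 : (a `^ p * K <= fine J)%R.
  have : (p^-1 * (a `^ p * K) <= p^-1 * fine J)%R by lra.
  by rewrite ler_pM2l// invr_gt0.
have := ler_wpM2r (powR_ge0 K (p - 1)) h1.
by move: (K `^ _)%R (a `^ p)%R (fine J) => *; lra.
Qed.

(** For finite p, integrate schur_jensen over x and exchange the integrals: p - 1
    of the p factors K are the mass of the kernel in t, the last one is its mass
    in x. For p = +oo only the mass in t enters. *)
Lemma schur_test (p : \bar R) (g h : T -> R) : 1 <= p ->
  measurable_fun setT g -> (forall t, (0 <= g t)%R) -> (forall x, (0 <= h x)%R) ->
  (forall x, (h x)%:E <= \int[mu]_t (k (x, t) * g t)%:E) ->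
  'N[mu]_p[EFin \o h] <= K%:E * 'N[mu]_p[EFin \o g].
Proof.
move=> p1 mg g0 h0 hI.
case: p p1 => [p||//].
  rewrite lee_fin => p1; have p0 : (0 < p)%R by exact: lt_le_trans p1.
  have mgp : measurable_fun setT (fun t => g t `^ p)%R.
    exact: (measurableT_comp (measurable_powR p) mg).
  rewrite unlock.
  under eq_integral do rewrite /= ger0_norm//.
  under [X in _ <= _ * X `^ _]eq_integral do rewrite /= ger0_norm//.
  set I := \int[mu]_x (g x `^ p)%:E.
  have I0 : 0 <= I by apply: integral_ge0 => t _; rewrite lee_fin powR_ge0.
  pose f z := (k z * g z.2 `^ p)%:E.
  have f0 z : 0 <= f z by rewrite lee_fin mulr_ge0// powR_ge0.
  have mf : measurable_fun setT f.
    apply/measurable_EFinP; apply: measurable_funM => //.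
    exact: (measurableT_comp mgp measurable_snd).
  have Kp1 : 0 <= (K `^ (p - 1))%:E by rewrite lee_fin powR_ge0.
  have main : \int[mu]_x (h x `^ p)%:E <= (K `^ p)%:E * I.
    apply: (@le_trans _ _ (\int[mu]_x ((K `^ (p - 1))%:E * \int[mu]_t f (x, t)))).
      apply: ge0_integral_mono => x; first by rewrite lee_fin powR_ge0.
      exact: schur_jensen.
    rewrite ge0_integralZl//; last 2 first.
    - exact: (measurable_fun_fubini_tonelli_F (m2 := mu) f).
    - by move=> x _; apply: integral_ge0.
    rewrite (fubini_tonelli f)//.
    rewrite -(mulr_powRB1 (ltW K0) p0) (mulrC K) EFinM -muleA.
    apply: lee_wpmul2l => //.
    rewrite -ge0_integralZl//; last 3 first.
    - by apply/measurable_EFinP.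
    - by move=> t _; rewrite lee_fin powR_ge0.
    - by rewrite lee_fin ltW.
    apply: ge0_integral_mono => t; first by apply: integral_ge0.
    rewrite /f /=; under eq_integral do rewrite EFinM ksym.
    rewrite ge0_integralZr//; last 3 first.
    - by apply/measurable_EFinP.
    - by move=> x _; rewrite lee_fin.
    - by rewrite lee_fin powR_ge0.
    by apply: lee_wpmul2r => //; rewrite lee_fin powR_ge0.
  have -> : K%:E = (K `^ p)%:E `^ p^-1.
    by rewrite poweR_EFin -powRrM divff ?gt_eqF// powRr1 ?ltW.
  rewrite -poweRM//; last by rewrite lee_fin powR_ge0.
  apply: gt0_ler_poweR; [by rewrite invr_ge0 ltW| | |exact: main].
  - rewrite in_itv/= leey andbT.
    by apply: integral_ge0 => t _; rewrite lee_fin powR_ge0.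
  - by rewrite in_itv/= leey andbT mule_ge0// lee_fin powR_ge0.
move=> _; rewrite unlock; case: ifPn => muT; last by rewrite mule0.
apply/ess_supP.
set E := ess_sup mu _.
have E0 : 0 <= E by apply: (ess_sup_gee muT); apply/nearW => t /=.
have [->|Ey] := eqVneq E +oo; first by apply: nearW => x; rewrite gt0_muley ?leey.
have /fineK EE : E \is a fin_num by rewrite ge0_fin_numE// ltey.
have gE : \forall t \ae mu, ((g t)%:E <= E)%E.
  have := @ess_sup_ge _ _ _ mu (abse \o (EFin \o g)).
  by apply: filterS => t /=; rewrite ger0_norm.
apply: nearW => x /=; rewrite ger0_norm//.
apply: (le_trans (hI x)).
apply: (@le_trans _ _ (\int[mu]_t ((fine E)%:E * (k (x, t))%:E))).
  apply: ae_ge0_le_integral => //.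
  - by move=> t _; rewrite lee_fin mulr_ge0.
  - by apply/measurable_EFinP; exact: measurable_funM.
  - by move=> t _; rewrite mule_ge0 ?EE ?lee_fin.
  - by apply: emeasurable_funM => //; apply/measurable_EFinP.
  - apply: filterS gE => t gt _; rewrite EE EFinM muleC.
    by apply: lee_wpmul2r => //; rewrite lee_fin.
rewrite EE ge0_integralZl//; last 2 first.
- by apply/measurable_EFinP.
- by move=> t _; rewrite lee_fin.
by rewrite muleC; apply: lee_wpmul2r.
Qed.

End schur.

(** * Complex-valued integrals *)

(** A copy of the measure of the torus that carries the finiteness which
    Tonelli's theorem asks for. *)
Definition torus_prob (R : realType) : set (measurableTypeR R) -> \bar R :=
  @torus_measure R.

HB.instance Definition _ (R : realType) :=
  Measure.copy (@torus_prob R) (@torus_measure R).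

Lemma torus_prob_fin (R : realType) : fin_num_fun (@torus_prob R).
Proof.
move=> A mA; rewrite ge0_fin_numE ?measure_ge0//.
apply: le_lt_trans (_ : 1 < +oo)%E; last exact: ltry.
by rewrite -(@torus_measureT R) /torus_prob; apply: le_measure; rewrite ?inE.
Qed.

HB.instance Definition _ (R : realType) :=
  @Measure_isFinite.Build _ _ _ (@torus_prob R) (@torus_prob_fin R).

Section complex_integral.
Context {R : realType}.
Local Notation mu := (@torus_measure R).
Implicit Types (f g h k : R -> R[i]) (c z : R[i]).

Definition cmeasurable f :=
  measurable_fun setT (fun x : R => complex.Re (f x)) /\
  measurable_fun setT (fun x : R => complex.Im (f x)).

Definition cintegrable f :=
  mu.-integrable setT (fun x => (complex.Re (f x))%:E) /\
  mu.-integrable setT (fun x => (complex.Im (f x))%:E).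

Lemma ReM z c : complex.Re (z * c) =
  complex.Re z * complex.Re c - complex.Im z * complex.Im c.
Proof. by case: z c => [? ?] []. Qed.

Lemma ImM z c : complex.Im (z * c) =
  complex.Re z * complex.Im c + complex.Im z * complex.Re c.
Proof. by case: z c => [? ?] []. Qed.

Lemma cmeasurable_cst c : cmeasurable (fun=> c).
Proof. by split; exact: measurable_cst. Qed.

Lemma cmeasurableD f g : cmeasurable f -> cmeasurable g ->
  cmeasurable (fun x => f x + g x).
Proof.
move=> [f1 f2] [g1 g2]; split.
  by under eq_fun do rewrite ReD; exact: measurable_funD.
by under eq_fun do rewrite ImD; exact: measurable_funD.
Qed.

Lemma cmeasurableM f g : cmeasurable f -> cmeasurable g ->
  cmeasurable (fun x => f x * g x).
Proof.
move=> [f1 f2] [g1 g2]; split.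
  under eq_fun do rewrite ReM.
  by apply: measurable_funB; exact: measurable_funM.
under eq_fun do rewrite ImM.
by apply: measurable_funD; exact: measurable_funM.
Qed.

Lemma cmeasurable_sum (I : Type) (s : seq I) (f : I -> R -> R[i]) :
  (forall i, cmeasurable (f i)) -> cmeasurable (fun x => \sum_(i <- s) f i x).
Proof.
move=> mf; elim: s => [|i s IH].
  by under eq_fun do rewrite big_nil; exact: cmeasurable_cst.
by under eq_fun do rewrite big_cons; exact: cmeasurableD.
Qed.

Lemma cmeasurable_cvg (u : nat -> R -> R[i]) f :
  (forall n, cmeasurable (u n)) -> (forall x, ccvg (u ^~ x) (f x)) ->
  cmeasurable f.
Proof.
move=> mu_ uf; split.
  apply: (@measurable_fun_cvg _ _ _ _ (fun n x => complex.Re (u n x))).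
    by move=> n; have [] := mu_ n.
  by move=> x _; have [] := uf x.
apply: (@measurable_fun_cvg _ _ _ _ (fun n x => complex.Im (u n x))).
  by move=> n; have [] := mu_ n.
by move=> x _; have [] := uf x.
Qed.

Lemma cmeasurable_psum (a : R -> R) n (x : R) :
  cmeasurable (fun t => psum a n (x - t)).
Proof.
apply: cmeasurable_sum => i; apply: cmeasurableM; first exact: cmeasurable_cst.
pose l (t : R) := (i%:R - n%:R) * (x - t).
have cl : continuous l.
  by move=> t; apply: cvgMr; apply: cvgB; [exact: cvg_cst|exact: cvg_id].
have cc : continuous (@cos R \o l).
  by move=> t; apply: continuous_comp; [exact: cl|exact: continuous_cos].
have cs : continuous (@sin R \o l).
  by move=> t; apply: continuous_comp; [exact: cl|exact: continuous_sin].
by split; [exact: continuous_measurable_fun cc|exact: continuous_measurable_fun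
    cs].
Qed.

Lemma measurable_normc f : cmeasurable f ->
  measurable_fun setT (fun x => normc (f x)).
Proof.
move=> [f1 f2].
rewrite (_ : (fun x => _) = Num.sqrt \o
  (fun x => complex.Re (f x) ^+ 2 + complex.Im (f x) ^+ 2)); last first.
  by apply/funext => x /=; case: (f x).
apply: measurableT_comp.
  by apply: continuous_measurable_fun; exact: sqrt_continuous.
by apply: measurable_funD; exact: measurable_funX.
Qed.

Lemma cintegrable_le f (b : R -> R) : cmeasurable f ->
  mu.-integrable setT (EFin \o b) -> (forall x, normc (f x) <= b x) ->
  cintegrable f.
Proof.
move=> [f1 f2] ib fb.
have bb x : normc (f x) <= `|b x| by rewrite (le_trans (fb x))// ler_norm.
split; apply: (le_integrable _ _ _ ib) => //.
- exact/measurable_EFinP.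
- by move=> x _; rewrite lee_fin (le_trans (Re_le_normc _)).
- exact/measurable_EFinP.
- by move=> x _; rewrite lee_fin (le_trans (Im_le_normc _)).
Qed.

Lemma cintegrableM k g (B : R) : cmeasurable k -> cmeasurable g ->
  (forall t, normc (k t) <= B) ->
  mu.-integrable setT (EFin \o (fun t => normc (g t))) ->
  cintegrable (fun t => k t * g t).
Proof.
move=> mk mg kB ig; apply: (@cintegrable_le _ (fun t => B * normc (g t))).
- exact: cmeasurableM.
- exact: (integrableZl measurableT B ig).
- move=> t; rewrite ComplexField.Normc.normcM ler_wpM2r//.
  exact: normc_ge0.
Qed.

Lemma cintegrable0 : cintegrable (fun=> 0).
Proof. by split; exact: integrable0. Qed.

Lemma cintegrableD f g : cintegrable f -> cintegrable g ->
  cintegrable (fun x => f x + g x).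
Proof.
move=> [f1 f2] [g1 g2]; split.
  by under eq_fun do rewrite ReD EFinD; exact: integrableD.
by under eq_fun do rewrite ImD EFinD; exact: integrableD.
Qed.

Lemma cintegralD f g : cintegrable f -> cintegrable g ->
  cintegral (fun x => f x + g x) = cintegral f + cintegral g.
Proof.
move=> [f1 f2] [g1 g2]; rewrite /cintegral.
under eq_Rintegral do rewrite ReD.
under [X in (_ +i* X)%C]eq_Rintegral do rewrite ImD.
by rewrite !RintegralD.
Qed.

Lemma cintegrableZ c f : cintegrable f -> cintegrable (fun x => c * f x).
Proof.
move=> [f1 f2]; split.
  under eq_fun do rewrite ReM EFinB !EFinM.
  by apply: integrableB => //; exact: integrableZl.
under eq_fun do rewrite ImM EFinD !EFinM.
by apply: integrableD => //; exact: integrableZl.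
Qed.

Lemma cintegralZ c f : cintegrable f ->
  cintegral (fun x => c * f x) = c * cintegral f.
Proof.
move=> [f1 f2]; rewrite /cintegral.
under eq_Rintegral do rewrite ReM.
under [X in (_ +i* X)%C]eq_Rintegral do rewrite ImM.
have Z (b : R) (u : R -> R) : mu.-integrable setT (EFin \o u) ->
    mu.-integrable setT (EFin \o (fun x => b * u x)).
  by move=> iu; exact: (integrableZl measurableT b iu).
rewrite RintegralB ?RintegralD// ?RintegralZl//; try exact: Z.
by case: c => a b; apply/eqP; rewrite eq_complex/= !eqxx.
Qed.

Lemma cintegral_lincomb (I : Type) (s : seq I) (c : I -> R[i])
    (h : I -> R -> R[i]) : (forall i, cintegrable (h i)) ->
  cintegrable (fun t => \sum_(i <- s) c i * h i t) /\
  cintegral (fun t => \sum_(i <- s) c i * h i t) =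
  \sum_(i <- s) c i * cintegral (h i).
Proof.
move=> ih; elim: s => [|i s [IH1 IH2]].
  under [X in cintegrable X]eq_fun do rewrite big_nil.
  under [X in cintegral X = _]eq_fun do rewrite big_nil.
  rewrite big_nil; split; first exact: cintegrable0.
  by rewrite /cintegral/= Rintegral_cst//= mul0r.
under [X in cintegrable X]eq_fun do rewrite big_cons.
under [X in cintegral X = _]eq_fun do rewrite big_cons.
have ic := cintegrableZ (c i) (ih i).
split; first exact: cintegrableD.
by rewrite big_cons cintegralD// IH2 cintegralZ.
Qed.

(** The factor 2 comes from bounding the two components separately. *)
Lemma normc_cintegral f : cmeasurable f -> cintegrable f ->
  ((normc (cintegral f))%:E <= \int[mu]_x (2 * normc (f x))%:E)%E.
Proof.
move=> mf [f1 f2].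
have mn := measurable_normc mf.
have mn2 : measurable_fun setT (fun x => (normc (f x))%:E).
  exact/measurable_EFinP.
have part (u : R -> R) : mu.-integrable setT (EFin \o u) ->
    (forall x, `|u x| <= normc (f x)) ->
    (`|Rintegral mu setT u|%:E <= \int[mu]_x (normc (f x))%:E)%E.
  move=> iu uf; rewrite EFin_normr_Rintegral//.
  apply: (le_trans (le_abse_integral _ _ _)) => //;
      first exact: measurable_int iu.
  apply: ge0_le_integral => //.
  - by apply: measurableT_comp => //; exact: measurable_int iu.
  - by move=> x _; rewrite lee_fin.
have h1 := part _ f1 (fun x => Re_le_normc (f x)).
have h2 := part _ f2 (fun x => Im_le_normc (f x)).
apply: (@le_trans _ _ (2%:E * \int[mu]_x (normc (f x))%:E)%E); last first.
  under [leRHS]eq_integral do rewrite EFinM.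
  rewrite ge0_integralZl//.
  by move=> x _; rewrite lee_fin normc_ge0.
apply: (@le_trans _ _ (`|Rintegral mu setT (fun x => complex.Re (f x))|%:E +
   `|Rintegral mu setT (fun x => complex.Im (f x))|%:E)%E).
  by rewrite -EFinD lee_fin; exact: normc_le_ReIm (cintegral f).
rewrite (_ : 2%:E = 1 + 1)%E; last by rewrite -EFinD.
by rewrite ge0_muleDl ?lee_fin// mul1e leeD.
Qed.

(** The torus has finite measure, so that L^p is contained in L^1. *)
Lemma Lp_torus_integrable (p : \bar R) g : (1 <= p)%E -> Lp_torus p g ->
  mu.-integrable setT (EFin \o (fun t => normc (g t))).
Proof.
move=> p1 [g1 g2 _ gp].
have mg : measurable_fun setT (fun t => normc (g t)) by exact: measurable_normc.
have gL : (fun t => normc (g t)) \in Lfun mu p.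
  by rewrite inE; apply/andP; split; rewrite inE.
apply/Lfun1_integrable.
apply: (@Lfun_subset _ _ _ mu 1 p (lexx _) p1 _ p1) gL.
exact: torus_prob_fin.
Qed.

End complex_integral.

(** * The error as an integral operator *)

Section error_integral.
Context {R : realType}.
Variables (theta lambda beta : R -> R) (r kappa : R).
Hypothesis theta_cutoff : cutoff theta.
Hypothesis lambda_mask : decay_mask r kappa lambda.
Hypothesis beta_exp : exponent_type beta.
Hypothesis r_gt1 : 1 < r.

Lemma cmeasurable_phi_lambda (x : R) :
  cmeasurable (fun t => phi lambda (x - t)).
Proof.
apply: (@cmeasurable_cvg _ (fun n t => psum lambda n (x - t))) => [n|t].
  exact: cmeasurable_psum.
exact: (mask_cvg lambda_mask r_gt1).
Qed.

(** All the integrals over g, in f and in the sampled values of V_m(g),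
    are collected into one. *)
Lemma error_integral (m : nat) (g : R -> R[i]) (x : R) : (0 < m)%N ->
  cmeasurable g ->
  (@torus_measure R).-integrable setT (EFin \o (fun t => normc (g t))) ->
  [/\ cmeasurable (fun t => error_kernel theta lambda beta m x t * g t),
      cintegrable (fun t => error_kernel theta lambda beta m x t * g t) &
      torus_conv (phi lambda) g x - Qm theta lambda beta m g x =
      cintegral (fun t => error_kernel theta lambda beta m x t * g t)].
Proof.
move=> m0 mg ig.
pose H := Hm theta lambda beta m.
have HE y : H y = psum (fun t => theta (t / m%:R) * (lambda t / beta t)) m y.
  by rewrite /H HmE.
have mH y : cmeasurable (fun t => H (y - t)).
  by under eq_fun do rewrite HE; exact: cmeasurable_psum.
have [BH hBH] : exists B : R, forall y, normc (H y) <= B.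
  pose h (t : R) := theta (t / m%:R) * (lambda t / beta t).
  exists (2 * \sum_(k < m.+1) (`|h k%:R| + `|h (- k%:R)|)) => y.
  rewrite HE; apply: (@normc_psum_le _ h m y
    (fun k => `|h k%:R| + `|h (- k%:R)|)) => k _.
    by rewrite lerDl.
  by rewrite lerDr.
have [BL hBL] : exists B : R, forall y, normc (phi lambda y) <= B.
  have [B hB] := mask_summable lambda_mask r_gt1.
  by exists (2 * (`|lambda 0| + B)) => y; exact: normc_phi_le.
pose N1 : R[i] := ((2 * m).+1%:R^-1)%:C%C.
pose c (k : 'I_(2 * m).+1) : R[i] := - (N1 * phi beta (x - node m k)).
have iH (k : 'I_(2 * m).+1) : cintegrable (fun t => H (node m k - t) * g t).
  by apply: (@cintegrableM _ _ _ BH).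
have iL : cintegrable (fun t => phi lambda (x - t) * g t).
  by apply: (@cintegrableM _ _ _ BL) => //; exact: cmeasurable_phi_lambda.
have EE t : error_kernel theta lambda beta m x t * g t =
    phi lambda (x - t) * g t + \sum_k c k * (H (node m k - t) * g t).
  rewrite /error_kernel mulrBl; congr (_ + _).
  rewrite -/N1 mulr_sumr mulr_suml -sumrN; apply: eq_bigr => k _.
  by rewrite /c -/H; ring.
have [iS intS] := cintegral_lincomb (index_enum _) c iH.
split.
- apply: cmeasurableM mg.
  have -> : error_kernel theta lambda beta m x = (fun t => phi lambda (x - t) +
      -1 * (N1 * \sum_(k < (2 * m).+1)
              H (node m k - t) * phi beta (x - node m k))).
    by apply/funext => t; rewrite mulN1r.
  apply: cmeasurableD; first exact: cmeasurable_phi_lambda.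
  apply: cmeasurableM; first exact: cmeasurable_cst.
  apply: cmeasurableM; first exact: cmeasurable_cst.
  apply: cmeasurable_sum => k; apply: cmeasurableM; last exact: cmeasurable_cst.
  exact: mH.
- by rewrite (funext EE); exact: cintegrableD.
- rewrite (funext EE) cintegralD// intS; congr (_ + _).
  rewrite /Qm -/N1 mulr_sumr -sumrN; apply: eq_bigr => k _.
  rewrite /c /Vm /torus_conv -/(node m k) -/H.
  by move: (cintegral _) => I; ring.
Qed.

End error_integral.

Theorem theorem2p10 (R : realType) (theta : R -> R) (p : \bar R) (r : R)
    (kappa : int) (lambda beta : R -> R)
    (theta_cutoff : cutoff theta)
    (p_ge1 : (1 <= p)%E)
    (r_gt1 : 1 < r)
    (lambda_neq0 : forall t, lambda t != 0)
    (lambda_bounded : exists M : R, forall t, `|lambda t| <= M)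
    (lambda_mask : decay_mask r kappa%:~R lambda)
    (beta_exp : exponent_type beta) :
  exists c : R, 0 < c /\
    forall f g : R -> R[i], in_H lambda p f g ->
    forall m : nat, (0 < m)%N ->
      (Lpnorm p (fun x => (f x - Qm theta lambda beta m g x)%R) <=
       (c * m%:R `^ (- r) * ln (m.+1%:R) `^ (- kappa%:~R))%:E *
         Lpnorm p g)%E.
Proof.
have [C C0 hC] := error_kernel_bound theta_cutoff lambda_mask beta_exp r_gt1.
(* 14 = 2 * 7, the constants of normc_cintegral and poisson_integral. *)
exists (14 * C); split; first by rewrite mulr_gt0.
move=> f g [Lg ->] m m0.
have [g1 g2 _ _] := Lg.
have mg : cmeasurable g by [].
have ig := Lp_torus_integrable p_ge1 Lg.
pose W : R := C * weight r kappa%:~R m%:R.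
have m1 : 1 <= m%:R :> R by rewrite ler1n.
have W0 : 0 < W by apply: mulr_gt0 => //; apply: weight_gt0; lra.
pose P (u : R) := poisson_bound m%:R u.
have P0 u : 0 <= P u by rewrite (le_trans ler01)// poisson_bound_ge1.
have cP : continuous P by exact: continuous_poisson.
pose k (z : R * R) : R := 2 * W * P (z.1 - z.2).
have mPx (x : R) : measurable_fun setT (fun t : R => P (x - t)).
  apply: continuous_measurable_fun => t.
  apply: (@continuous_comp _ _ _ (fun t => x - t) P); last exact: cP.
  by apply: cvgB; [exact: cvg_cst|exact: cvg_id].
have mk : measurable_fun setT k.
  apply: measurable_funM; first exact: measurable_cst.
  apply: (@measurableT_comp _ _ _ _ _ _ P);
      first exact: continuous_measurable_fun.
  exact: measurable_funB measurable_fst measurable_snd.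
have k0 z : 0 <= k z.
  by apply: mulr_ge0 => //; apply: mulr_ge0 => //; exact: ltW.
have ksym x t : k (x, t) = k (t, x).
  by rewrite /k /= -[x - t]opprB /P poisson_boundN.
have K0 : 0 < 2 * W * 7 by rewrite mulr_gt0// mulr_gt0.
have kK x : (\int[torus_prob (R := R)]_t (k (x, t))%:E <= (2 * W * 7)%:E)%E.
  have W20 : 0 <= 2 * W by rewrite mulr_ge0// ltW.
  have := integral_scale (torus_prob (R := R)) W20 (mPx x) (fun t => P0 _).
  rewrite /k /= => <-; rewrite [leRHS]EFinM.
  apply: lee_wpmul2l; first by rewrite lee_fin.
  by apply: poisson_integral; lra.
have := @schur_test _ _ _ (torus_prob (R := R)) k (2 * W * 7) mk k0 ksym K0 kK p
  (fun t => normc (g t))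
  (fun x => normc (torus_conv (phi lambda) g x - Qm theta lambda beta m g x))
  p_ge1 (measurable_normc mg) (fun t => normc_ge0 _) (fun x => normc_ge0 _).
have -> : 14 * C * m%:R `^ (- r) * ln m.+1%:R `^ (- kappa%:~R) = 2 * W * 7.
  by rewrite /W /weight natr1; ring.
apply => x.
have [mD iD ->] := @error_integral _ _ _ beta _ _ theta_cutoff lambda_mask r_gt1
  m g x m0 mg ig.
apply: (le_trans (normc_cintegral mD iD)).
apply: (@ge0_integral_mono _ _ _ (torus_prob (R := R))) => t.
  by rewrite lee_fin; apply: mulr_ge0 => //; exact: normc_ge0.
rewrite lee_fin ComplexField.Normc.normcM /k /= -2!(mulrA 2) ler_pM2l//.
by apply: ler_wpM2r; [exact: normc_ge0|exact: hC].
Qed.
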